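(* Let $\gamma>0$ and $\theta>0$. Generate a feature allocation from the jumps on $[0,1]$ of the beta process subordinator with zero drift and Lévy measure $$\Lambda(d\xi)=\gamma\,\theta\,\xi^{-1}(1-\xi)^{\theta-1}\,d\xi,\qquad \xi\in(0,1),$$ and let $(\xi_k)_{k\ge 1}$ be the sequence of its jump sizes indexed in order of appearance. Let $(V_k)_{k\ge1}$ be the sequence of Indian buffet process stick lengths with mass parameter $\gamma$ and concentration parameter $\theta$. Then the sequence $(\xi_k)_{k\ge1}$ has the same distribution as the sequence $(V_k)_{k\ge 1}$.
   Context: Subordinator. A subordinator $(T_s)_{s\ge 0}$ is a stochastic process with nonnegative, nondecreasing, right-continuous paths with left limits and stationary independent increments. A zero-drift subordinator with Lévy measure $\Lambda$ has the form $T_s=\sum_k \xi_k \mathbf{1}\{\phi_k\le s\}$, where $\{(\xi_k,\phi_k)\}_k$ are the points of a Poisson point process with intensity $\Lambda(d\xi)\,d\phi$. Only the jumps with locations $\phi_k\in[0,1]$ are used; their sizes form a Poisson point process on $(0,1)$ with intensity $\Lambda(d\xi)$. Feature allocation generated from the subordinator. There is one feature for each jump. Conditionally on the jumps, for each data index $n\in\{1,2,\ldots\}$ and each jump of size $\xi$, index $n$ belongs to the feature of that jump with probability $\xi$, by Bernoulli draws that are independent across all indices and all jumps. Order of appearance. The jumps are enumerated as follows: first all jumps whose feature contains index $1$; then all jumps whose feature contains index $2$ but not index $1$; and, in general, on round $n$, all jumps whose feature contains index $n$ but none of the indices $1,\ldots,n-1$. Within a single round, the jumps are ordered uniformly at random,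 independently of everything else. $\xi_k$ denotes the size of the $k$th jump in this enumeration. Indian buffet process stick lengths. Let $K_0=0$. For $n=1,2,\ldots$ let $$K_n^+\sim \mathrm{Poisson}\left(\frac{\gamma\theta}{\theta+n-1}\right)\ \text{independently},\qquad K_n=K_{n-1}+K_n^+,$$ and, conditionally on $(K_n^+)_{n\ge1}$, let the $V_k$ be independent with $$V_k\sim \mathrm{Beta}(1,\theta+n-1),\qquad k=K_{n-1}+1,\ldots,K_n.$$ Here $\mathrm{Beta}(a,b)$ is the distribution on $(0,1)$ with density proportional to $x^{a-1}(1-x)^{b-1}$. *)

(* Defs.v *)
From HB Require Import structures.
From mathcomp Require Import all_boot all_order all_algebra.
From mathcomp Require Import all_classical all_reals all_analysis.
From mathcomp Require Import measurable_realfun.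
Set Implicit Arguments.
Unset Strict Implicit.
Unset Printing Implicit Defensive.
Import Order.TTheory GRing.Theory Num.Theory.
Import numFieldNormedType.Exports.
Local Open Scope classical_set_scope.
Local Open Scope ring_scope.

(* Data indices n = 1, 2, ... and positions k = 1, 2, ... in a sequence are
   shifted to start at 0 throughout. *)

Definition sigma_gen (Omega : Type) (I : Type) (d : measure_display)
    (E : measurableType d) (X : I -> Omega -> E) : set (set Omega) :=
  <<s \bigcup_i preimage_set_system setT (X i) measurable >>.

Section Independence.
Context (d : measure_display) (Omega : measurableType d) (R : realType).
Context (P : probability Omega R) (I : eqType).
Context (d' : measure_display) (E : measurableType d').
Local Open Scope ereal_scope.

Definition mutually_independent (X : I -> Omega -> E) : Prop :=
  forall (J : seq I) (B : I -> set E), uniq J -> (forall i, measurable (B i)) ->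
    P (\bigcap_(i in [set` J]) X i @^-1` B i) =
    \prod_(i <- J) P (X i @^-1` B i).

(* Given the sigma-algebra G, the X i are independent and X i has the random
   law Q i; each Q i w is a probability measure for almost every w, and
   w |-> Q i w B is G-measurable for every use below. *)
Definition cond_independent_with_law (G : set (set Omega))
    (X : I -> Omega -> E) (Q : I -> Omega -> set E -> \bar R) : Prop :=
  forall (A : set Omega) (J : seq I) (B : I -> set E),
    G A -> uniq J -> (forall i, measurable (B i)) ->
    P (A `&` \bigcap_(i in [set` J]) X i @^-1` B i) =
    \int[P]_(w in A) \prod_(i <- J) Q i w (B i).

End Independence.

Section PointProcess.
Context (d : measure_display) (Omega : measurableType d) (R : realType).
Context (P : probability Omega R).
Local Open Scope ereal_scope.

Definition point_count (d' : measure_display) (E : measurableType d')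
    (X : nat -> Omega -> E) (B : set E) (w : Omega) : \bar R :=
  \sum_(k <oo) (\1_B (X k w))%:E.

(* Poisson law with mean m in [0, +oo].  The second argument of [poisson_prob]
   is a dummy. *)
Definition has_poisson_law (N : Omega -> \bar R) (m : \bar R) : Prop :=
  if m == +oo then P [set w | N w = +oo] = 1
  else forall j : nat,
    P [set w | N w = (j%:R)%:E] = poisson_prob (fine m) 0 [set j].

(* The points are listed as X 0, X 1, ..., with multiplicity, so this
   describes processes with infinitely many points, i.e. m setT = +oo; this is
   the case of the jumps of a subordinator with a nonzero Levy measure. *)
Definition poisson_point_process (d' : measure_display)
    (E : measurableType d') (X : nat -> {RV P >-> E})
    (m : {measure set E -> \bar R}) : Prop :=
  (forall B, measurable B -> has_poisson_law (point_count X B) (m B)) /\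
  (forall B : nat -> set E,
      (forall i, measurable (B i)) -> trivIset setT B ->
      mutually_independent P (fun i => point_count X (B i))).

(* Only the times s >= 0 are meaningful. *)
Record is_subordinator (T : R -> {RV P >-> R}) : Prop := IsSubordinator {
  sub_ge0 : forall w s, (0 <= s)%R -> (0 <= T s w)%R ;
  sub_nondecreasing :
    forall w s t, (0 <= s)%R -> (s <= t)%R -> (T s w <= T t w)%R ;
  sub_right_continuous :
    forall w s, (0 <= s)%R -> T t w @[t --> s^'+] --> T s w ;
  sub_left_limits :
    forall w s, (0 < s)%R -> cvg (T t w @[t --> s^'-]) ;
  sub_stationary_increments :
    forall s h B, (0 <= s)%R -> (0 <= h)%R -> measurable B ->
      P ((fun w => T (s + h) w - T s w)%R @^-1` B) =
      P ((fun w => T h w - T 0 w)%R @^-1` B) ;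
  sub_independent_increments :
    forall t : nat -> R, (0 <= t 0%N)%R -> (forall i, t i <= t i.+1)%R ->
      mutually_independent P (fun i w => T (t i.+1) w - T (t i) w)%R }.

(* The intensity Lambda(dxi) dphi on sizes xi and locations phi >= 0. *)
Definition jump_intensity (Lambda : {measure set (measurableTypeR R) -> \bar R})
    : {measure set (measurableTypeR R * measurableTypeR R) -> \bar R} :=
  mrestr (Lambda \x lebesgue_measure)
    (measurableX measurableT (measurable_itv `[0%R, +oo[)).

(* [jump k w] is the pair (size, location) of the jump labelled k. *)
Record zero_drift_subordinator (Lambda : {measure set (measurableTypeR R) -> \bar R})
    (T : R -> {RV P >-> R})
    (jump : nat -> {RV P >-> (measurableTypeR R * measurableTypeR R)%type})
    : Prop :=
  ZeroDriftSubordinator {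
  zds_subordinator : is_subordinator T ;
  zds_jumps : poisson_point_process jump (jump_intensity Lambda) ;
  zds_sum_of_jumps :
    {ae P, forall w, forall s, (0 <= s)%R ->
      (T s w)%:E = \sum_(k <oo | ((jump k w).2 <= s)%R) ((jump k w).1)%:E} }.

End PointProcess.


Section BetaProcess.
Context (R : realType) (gamma theta : R).

Definition beta_process_density (x : R) : R :=
  gamma * theta * x^-1 * (1 - x) `^ (theta - 1).

(* The positivity proofs are needed only for this to be a measure. *)
Definition beta_process_levy of 0 < gamma & 0 < theta :
    set (measurableTypeR R) -> \bar R :=
  fun B => (\int[lebesgue_measure]_(x in B `&` `]0%R, 1%R[)
             (beta_process_density x)%:E)%E.

Hypotheses (gamma_gt0 : 0 < gamma) (theta_gt0 : 0 < theta).
Local Notation levy := (beta_process_levy gamma_gt0 theta_gt0).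

Let density_ge0 (x : R) : `]0%R, 1%R[%classic x -> 0 <= beta_process_density x.
Proof.
rewrite /= in_itv/= => /andP[x0 _].
by rewrite /beta_process_density !mulr_ge0 ?powR_ge0 ?invr_ge0// ltW.
Qed.

Let levy0 : levy set0 = 0%E.
Proof. by rewrite /beta_process_levy set0I integral_set0. Qed.

Let levy_ge0 B : (0 <= levy B)%E.
Proof.
by apply: integral_ge0 => x [_ x01]; rewrite lee_fin density_ge0.
Qed.

Let measurable_density :
  measurable_fun (`]0%R, 1%R[ : set (measurableTypeR R))
    (fun x => (beta_process_density x)%:E).
Proof.
apply/measurable_EFinP/measurable_funM; last first.
  apply: (measurableT_comp (measurable_powR _)).
  exact: measurable_funB.
apply: measurable_funM => //.
apply: open_continuous_measurable_fun; first exact: interval_open.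
move=> x; rewrite inE/= in_itv/= => /andP[x0 _].
by apply: inv_continuous; rewrite gt_eqF.
Qed.

Let levy_sigma_additive : semi_sigma_additive levy.
Proof.
move=> F mF tF mUF; apply: cvg_toP.
  by apply: ereal_nondecreasing_is_cvgn => m n mn; exact: lee_sum_nneg_natr.
rewrite /beta_process_levy setI_bigcupl ge0_integral_bigcup//.
- by move=> k; exact: measurableI.
- apply: measurable_funS measurable_density => //.
  by move=> x [k _ []].
- by move=> x [k _ [_ x01]]; rewrite lee_fin density_ge0.
- exact: trivIset_setIr.
Qed.

HB.instance Definition _ := isMeasure.Build _ _ _ levy
  levy0 levy_ge0 levy_sigma_additive.

End BetaProcess.

Section FeatureAllocation.
Context (d : measure_display) (Omega : measurableType d) (R : realType).
Context (P : probability Omega R).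
Context (jump : nat -> {RV P >-> (measurableTypeR R * measurableTypeR R)%type}).

(* [Z k n w] says that index n belongs to the feature of jump k.  Jumps whose
   location is outside [0, 1] are not used: their feature is empty. *)
Definition inclusion_probability (k : nat) (w : Omega) : R :=
  if 0 <= (jump k w).2 <= 1 then (jump k w).1 else 0.

Definition feature_allocation (Z : nat -> nat -> {RV P >-> bool}) : Prop :=
  cond_independent_with_law P (sigma_gen jump)
    (fun kn : nat * nat => Z kn.1 kn.2)
    (fun kn w => bernoulli_prob (inclusion_probability kn.1 w)).

Definition appears_at (Z : nat -> nat -> {RV P >-> bool}) (w : Omega)
    (k n : nat) : Prop :=
  Z k n w /\ forall m, (m < n)%N -> ~~ Z k m w.

(* [s i] is the label of the i-th jump, counting from 0.  If only finitely many
   jumps have a nonempty feature, the remaining values of s are not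
   constrained. *)
Definition lists_by_appearance (Z : nat -> nat -> {RV P >-> bool}) (w : Omega)
    (s : nat -> nat) : Prop :=
  (forall i j n, (i < j)%N -> appears_at Z w (s j) n ->
     s i <> s j /\ exists2 m, (m <= n)%N & appears_at Z w (s i) m) /\
  (forall k n, appears_at Z w k n -> exists i, s i = k).

Definition first_rounds_are (Z : nat -> nat -> {RV P >-> bool})
    (b : seq (seq nat)) : set Omega :=
  [set w | forall n k, (n < size b)%N ->
     (k \in nth [::] b n <-> appears_at Z w k n)].

Record order_of_appearance (Z : nat -> nat -> {RV P >-> bool})
    (sigma : nat -> {RV P >-> nat}) : Prop := OrderOfAppearance {
  ooa_lists : {ae P, forall w, lists_by_appearance Z w (fun i => sigma i w)} ;
  (* Given all jumps and Bernoulli draws, the orders within the rounds are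
     independent and uniform: when the rounds 0, ..., size b - 1 consist of the
     entries of the lists in b, sigma lists them in precisely the order given
     by b with conditional probability the product of the 1 / (size s)!, for s
     in b. *)
  ooa_uniform : forall (A : set Omega) (b : seq (seq nat)),
    <<s sigma_gen jump `|` sigma_gen (fun kn : nat * nat => Z kn.1 kn.2) >> A ->
    all uniq b ->
    P (A `&` first_rounds_are Z b `&`
       [set w | forall i, (i < size (flatten b))%N ->
                  sigma i w = nth 0%N (flatten b) i]) =
    ((\prod_(s <- b) ((size s)`!%:R)^-1)%:E * P (A `&` first_rounds_are Z b))%E }.

End FeatureAllocation.

Section IBP.
Context (R : realType).

(* The library's [beta_prob] has natural number parameters only. *)
Definition beta_law (a b : R) (B : set R) : \bar R :=
  let f (x : R) := (x `^ (a - 1) * (1 - x) `^ (b - 1))%:E in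
  ((\int[lebesgue_measure]_(x in B `&` `]0%R, 1%R[) f x) *
   ((fine (\int[lebesgue_measure]_(x in `]0%R, 1%R[) f x))^-1)%:E)%E.

Context (d : measure_display) (Omega : measurableType d).
Context (P : probability Omega R).

(* [Kplus n] is the number of sticks of round n, so this is the n with
   K_n <= k < K_(n+1) in terms of the partial sums K (and 0 if there is none). *)
Definition ibp_round (Kplus : nat -> {RV P >-> nat}) (k : nat) (w : Omega)
    : nat :=
  xget 0%N [set n | (\sum_(m < n) Kplus m w <= k
                     < \sum_(m < n.+1) Kplus m w)%N].

Record ibp_stick_lengths (gamma theta : R) (Kplus : nat -> {RV P >-> nat})
    (V : nat -> {RV P >-> R}) : Prop := IBPStickLengths {
  ibp_counts : forall n (A : set nat),
    distribution P (Kplus n) A =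
    poisson_prob (gamma * theta / (theta + n%:R)) 0 A ;
  ibp_counts_independent : mutually_independent P Kplus ;
  ibp_sticks : cond_independent_with_law P (sigma_gen Kplus) V
    (fun k w => beta_law 1 (theta + (ibp_round Kplus k w)%:R)) }.

End IBP.

(* R^N carries the product sigma-algebra, generated by the coordinates. *)
Definition same_sequence_law (R : realType) (d1 d2 : measure_display)
    (O1 : measurableType d1) (O2 : measurableType d2)
    (P1 : probability O1 R) (P2 : probability O2 R)
    (X : nat -> O1 -> R) (Y : nat -> O2 -> R) : Prop :=
  forall C : set (nat -> R), sigma_gen (fun k (x : nat -> R) => x k) C ->
    P1 [set w | C (fun k => X k w)] = P2 [set w | C (fun k => Y k w)].

(* Main.v *)
(* Condition on the jumps.  For distinct labels l_1, ..., l_n assigned to the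
   rounds r_1, ..., r_n < N, the probability that the first N rounds consist of
   exactly these jumps is the product of the weights x (1 - x)^r_i at the jumps
   l_i and of the weights (1 - x)^N at all the other jumps; the uniform order
   within a round of size k contributes a factor 1 / k!.  Summing over the labels
   gives an expectation of a sum over distinct points of the Poisson
   process; by the multivariate Mecke formula it factors into one integral
   against the intensity for each l_i, times exp (- int (1 - (1 - x)^N)).  Since
   the measure x (1 - x)^j Lambda(dx) is gamma theta / (theta + j) times
   Beta(1, theta + j), and 1 - (1 - x)^N is the sum of the x (1 - x)^j for
   j < N, this is the joint law of the Poisson counts of the first N rounds and
   of their Beta distributed sizes.

   The Mecke formula is derived from the Laplace functional
   E prod_l g(X_l) = exp (- int (1 - g)) by induction on the number of points:
   replacing g by g + t f or g - t f and letting t tend to 0 inserts one more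
   point with weight f.

   It is enough to prove that the sticks charge every box at most as much as
   the sorted jump sizes do, so only lower bounds for the law of the sorted jump
   sizes are needed. *)
Require Import Defs.
From HB Require Import structures.
From mathcomp Require Import all_boot all_order all_algebra.
From mathcomp Require Import all_classical all_reals all_analysis.
From mathcomp Require Import measurable_realfun.
From mathcomp Require Import ring lra.
Set Implicit Arguments.
Unset Strict Implicit.
Unset Printing Implicit Defensive.
Import Order.TTheory GRing.Theory Num.Theory.
Import numFieldNormedType.Exports.
Local Open Scope classical_set_scope.
Local Open Scope ring_scope.

(** * Sums over distinct points of a sequence *)

(** Since the points carry labels, the labels already used are left out of the infinite product
    instead of being divided out; [g] may vanish. Expanding this product to first order in t gives
    one inequality in each direction, both valid for every small t > 0. They replace a
    differentiation under the expectation.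

    The perturbed functions g + t f and g - t f must stay in [0, 1], which is why f is required to
    be at most C g and at most C (1 - g). For f = x (1 - x)^r with r < N and g = (1 - x)^N the first
    bound fails near x = 1. The sizes are therefore first kept below some q < 1, and the limit q ->
    1 is taken on the stick side, where the law is explicit.

    From rounds to boxes: the first n sizes are read off from N rounds as soon as these contain n
    jumps. Such an N exists almost surely because the rates gamma theta / (theta + j) have a
    divergent sum. This is proved for the sticks; for the jumps the total mass 1 does the rest. *)

Section FinProd.
Context (R : realType).
Implicit Types (s : seq nat) (a c : nat -> R).

Definition prodn s a L : R := \prod_(0 <= l < L | l \notin s) a l.

Lemma prodnS s a L : prodn s a L.+1 = prodn s a L * (if L \in s then 1 else a L).
Proof.
rewrite /prodn big_mkcond big_nat_recr//= -big_mkcond/=.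
by case: (L \in s).
Qed.

Lemma prodn0 s a : prodn s a 0 = 1.
Proof. by rewrite /prodn big_geq. Qed.

Lemma prodn_ge0 s a L : (forall l, 0 <= a l) -> 0 <= prodn s a L.
Proof. by move=> a0; apply: prodr_ge0. Qed.

Lemma prodn_nonincreasing s a : (forall l, 0 <= a l <= 1) ->
  nonincreasing_seq (prodn s a).
Proof.
move=> a01; apply/nonincreasing_seqP => L; rewrite prodnS ler_piMr//.
  by apply: prodn_ge0 => l; case/andP: (a01 l).
by case: ifP => // _; case/andP: (a01 L).
Qed.

Lemma prodn_rcons_out s a l L : (L <= l)%N -> prodn (rcons s l) a L = prodn s a L.
Proof.
move=> Ll; rewrite /prodn big_nat_cond [RHS]big_nat_cond; apply: eq_bigl => i.
rewrite mem_rcons inE negb_or leq0n/=.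
by case: (ltnP i L) => //= iL; rewrite ltn_eqF ?(leq_trans iL)//.
Qed.

(** Of the expansion of the product of the a_l + c_l, only the terms with at most one factor c_l are
    kept; the discarded ones are nonnegative. *)
Lemma prodn_addr_ge s a c L :
  (forall l, 0 <= a l) -> (forall l, 0 <= c l) ->
  prodn s a L +
    \sum_(0 <= l < L) (l \notin s)%:R * c l * prodn (rcons s l) a L <=
  prodn s (a \+ c) L.
Proof.
move=> a0 c0; elim: L => [|L IH]; first by rewrite !prodn0 big_geq// addr0.
rewrite big_nat_recr//= !prodnS mem_rcons inE eqxx/= mulr1.
rewrite prodn_rcons_out//.
have eqS : \sum_(0 <= i < L) (i \notin s)%:R * c i * prodn (rcons s i) a L.+1 =
    (\sum_(0 <= i < L) (i \notin s)%:R * c i * prodn (rcons s i) a L) *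
    (if L \in s then 1 else a L).
  rewrite big_distrl/=; apply: eq_big_nat => i /andP[_ iL].
  by rewrite prodnS mem_rcons inE gtn_eqF//= mulrA.
rewrite {}eqS; case: (boolP (L \in s)) => Ls /=.
  by rewrite !mulr1 !mul0r addr0.
set S := \sum_(0 <= i < L) _ in IH *.
have S0 : 0 <= S by apply: sumr_ge0 => i _; rewrite !mulr_ge0// prodn_ge0.
have := ler_wpM2r (addr_ge0 (a0 L) (c0 L)) IH.
apply: le_trans.
have := mulr_ge0 S0 (c0 L); lra.
Qed.

(** Telescoping: the factors a_l + c_l are replaced by a_l one at a time from the left. Replacing
    the l-th one costs c_l times a product without l, whose earlier factors are then raised back to
    a + c. [L] counts the replacements and [L'] is the length of the product, so that [L'] can tend
    to infinity first. *)
Lemma prodn_addr_le s a c L L' : (L <= L')%N ->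
  (forall l, 0 <= a l) -> (forall l, 0 <= c l) ->
  (forall l, a l + c l <= 1) ->
  prodn s (a \+ c) L' <= prodn s a L +
    \sum_(0 <= l < L) (l \notin s)%:R * c l * prodn (rcons s l) (a \+ c) L'.
Proof.
move=> LL' a0 c0 ac1.
have ac01 l : 0 <= (a \+ c) l <= 1 by rewrite /= addr_ge0 ?ac1.
(* [prodn s a L * tl L] is the hybrid product after [L] replacements. *)
pose tl L := \prod_(L <= l < L' | l \notin s) (a \+ c) l.
have tl0 k : 0 <= tl k by apply: prodr_ge0 => l _; case/andP: (ac01 l).
have tl1 k : tl k <= 1 by apply: prodr_ile1 => l _; exact: ac01.
suff H : prodn s (a \+ c) L' <= prodn s a L * tl L +
    \sum_(0 <= l < L) (l \notin s)%:R * c l * prodn (rcons s l) (a \+ c) L'.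
  apply: le_trans H _; rewrite lerD2r ler_piMr// prodn_ge0//.
elim: L LL' => [|L IH] LL'.
  by rewrite prodn0 big_geq// addr0 mul1r.
apply: (le_trans (IH (ltnW LL'))).
rewrite big_nat_recr//= addrA -addrAC lerD2r.
have tlS : tl L = (if L \in s then 1 else a L + c L) * tl L.+1.
  by rewrite /tl big_mkcond big_ltn//= -big_mkcond/=; case: (L \in s).
rewrite prodnS tlS; case: (boolP (L \in s)) => Ls /=.
  by rewrite !mulr1 !mul1r !mul0r addr0.
rewrite mul1r mulrDl mulrDr -mulrA lerD2l mulrCA ler_wpM2l//.
have -> : prodn (rcons s L) (a \+ c) L' = prodn s (a \+ c) L * tl L.+1.
  rewrite [LHS](@big_cat_nat _ _ _ L.+1)//=; congr (_ * _).
    rewrite -[LHS]/(prodn (rcons s L) (a \+ c) L.+1).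
    by rewrite prodnS mem_rcons inE eqxx/= mulr1 prodn_rcons_out.
  rewrite /tl big_nat_cond [RHS]big_nat_cond; apply: eq_bigl => i.
  rewrite mem_rcons inE negb_or; case: (ltnP L i) => //= Li.
  by rewrite gtn_eqF.
rewrite ler_wpM2r//; apply: ler_prod => i _; rewrite a0/= lerDl//.
Qed.

Definition prodx s a : R := limn (prodn s a).

Section prodx.
Variables (s : seq nat) (a : nat -> R).
Hypothesis a01 : forall l, 0 <= a l <= 1.

Let a0 l : 0 <= a l. Proof. by case/andP: (a01 l). Qed.

Lemma cvg_prodx : prodn s a @ \oo --> prodx s a.
Proof.
apply: nonincreasing_is_cvgn; first exact: prodn_nonincreasing.
by exists 0 => _ [L _ <-]; exact: prodn_ge0.
Qed.

Lemma prodx_ge0 : 0 <= prodx s a.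
Proof.
apply: limr_ge; first exact: cvg_prodx.
by apply: nearW => L; exact: prodn_ge0.
Qed.

Lemma prodx_le L : prodx s a <= prodn s a L.
Proof.
by apply: nonincreasing_cvgn_ge; [exact: prodn_nonincreasing|exact: cvg_prodx].
Qed.

Lemma prodx_le1 : prodx s a <= 1.
Proof. by rewrite -(prodn0 s a) prodx_le. Qed.

End prodx.

Lemma prodx_addr_ge s a c :
  (forall l, 0 <= a l) -> (forall l, 0 <= c l) -> (forall l, a l + c l <= 1) ->
  ((prodx s a)%:E +
    \sum_(0 <= l <oo) ((l \notin s)%:R * c l * prodx (rcons s l) a)%:E <=
  (prodx s (a \+ c))%:E)%E.
Proof.
move=> a0 c0 ac1.
have a01 l : 0 <= a l <= 1 by rewrite a0 (le_trans _ (ac1 l))// lerDl.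
have ac01 l : 0 <= (a \+ c) l <= 1 by rewrite /= addr_ge0 ?ac1.
(* Unrelated truncations of the sum and of the product let the two limits be taken one after the
   other; the comparison itself happens at [maxn L M]. *)
have H L M : prodx s a +
    \sum_(0 <= l < M) (l \notin s)%:R * c l * prodx (rcons s l) a <=
    prodn s (a \+ c) L.
  apply: (@le_trans _ _ (prodn s (a \+ c) (maxn L M))); last first.
    by apply: prodn_nonincreasing => //; rewrite leq_maxl.
  apply: le_trans (prodn_addr_ge _ (maxn L M) a0 c0); apply: lerD; first exact: prodx_le.
  apply: (@le_trans _ _ (\sum_(0 <= l < M)
      (l \notin s)%:R * c l * prodn (rcons s l) a (maxn L M))).
    by apply: ler_sum => i _; rewrite ler_wpM2l ?mulr_ge0// prodx_le.
  rewrite (@big_cat_nat _ _ _ M 0 (maxn L M))//= ?leq_maxr// lerDl sumr_ge0// => i _.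
  by rewrite !mulr_ge0// prodn_ge0.
rewrite -leeBrDl// -EFinB; apply: lime_le.
  apply: is_cvg_nneseries => l _ _; rewrite lee_fin !mulr_ge0//.
  exact: prodx_ge0.
apply: nearW => M; rewrite sumEFin lee_fin lerBrDl.
apply: limr_ge; first exact: cvg_prodx.
by apply: nearW => L; exact: H.
Qed.

Lemma prodx_addr_le s a c :
  (forall l, 0 <= a l) -> (forall l, 0 <= c l) -> (forall l, a l + c l <= 1) ->
  ((prodx s (a \+ c))%:E <= (prodx s a)%:E +
    \sum_(0 <= l <oo)
      ((l \notin s)%:R * c l * prodx (rcons s l) (a \+ c))%:E)%E.
Proof.
move=> a0 c0 ac1.
have a01 l : 0 <= a l <= 1 by rewrite a0 (le_trans _ (ac1 l))// lerDl.
have ac01 l : 0 <= (a \+ c) l <= 1 by rewrite /= addr_ge0 ?ac1.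
have H L : prodx s (a \+ c) <= prodn s a L +
    \sum_(0 <= l < L) (l \notin s)%:R * c l * prodx (rcons s l) (a \+ c).
  (* With [L] fixed the sum is finite, so the limit in [L'] passes through it. *)
  have cL : (fun L' => prodn s a L +
      \sum_(0 <= l < L) (l \notin s)%:R * c l * prodn (rcons s l) (a \+ c) L') @ \oo
      --> prodn s a L +
    \sum_(0 <= l < L) (l \notin s)%:R * c l * prodx (rcons s l) (a \+ c).
    apply: cvgD; first exact: cvg_cst.
    apply: (@cvg_big _ _ _ _ _ _ _ _ (index_iota 0 L)) => [|i _].
      exact: add_continuous.
    by apply: cvgM; [exact: cvg_cst|exact: cvg_prodx].
  rewrite -(cvg_lim _ cL)//; apply: ler_lim; first exact: cvg_prodx.
    by apply/cvg_ex; eexists; exact: cL.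
  apply: filterS (nbhs_infty_ge L) => L' LL'.
  exact: prodn_addr_le.
have T0 l : (0 <= ((l \notin s)%:R * c l * prodx (rcons s l) (a \+ c))%:E)%E.
  by rewrite lee_fin !mulr_ge0//; exact: prodx_ge0.
have [->|] := eqVneq (\sum_(0 <= l <oo)
      ((l \notin s)%:R * c l * prodx (rcons s l) (a \+ c))%:E)%E +oo%E.
  by rewrite addey// leey.
rewrite -ltey => Sfin.
rewrite -leeBlDr; last by rewrite ge0_fin_numE// nneseries_ge0.
set S := (X in (_ - X)%E); have Sf : S \is a fin_num.
  by rewrite ge0_fin_numE// nneseries_ge0.
rewrite -(fineK Sf) -EFinB lee_fin.
apply: limr_ge; first exact: cvg_prodx.
apply: nearW => L; rewrite lerBlDr; apply: le_trans (H L) _.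
rewrite lerD2l -lee_fin (fineK Sf) -sumEFin.
exact: nneseries_lim_ge.
Qed.

End FinProd.

Section DistinctSum.
Context (R : realType) (E : Type).
Implicit Types (fs : seq (E -> R)) (f g : E -> R) (s : seq nat) (x : nat -> E).

(* The sum of f_1(x_(l_1)) ... f_n(x_(l_n)) prod_l g(x_l) over all tuples of
   distinct labels l_i not in s, where the product is over the labels l which
   are neither in s nor among the l_i. *)
Fixpoint distinct_sum fs g s x : \bar R :=
  if fs is f :: fs' then
    \sum_(0 <= l <oo)
      ((l \notin s)%:R * f (x l))%:E * distinct_sum fs' g (rcons s l) x
  else (prodx s (g \o x))%:E.

Lemma distinct_sum_ge0 fs g s x : {in fs, forall f z, 0 <= f z} ->
  (forall z, 0 <= g z <= 1) -> (0 <= distinct_sum fs g s x)%E.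
Proof.
move=> fs0 g01; elim: fs fs0 s => [|f fs IH] fs0 s /=.
  by rewrite lee_fin prodx_ge0// => l; exact: g01.
apply: nneseries_ge0 => l _ _; rewrite mule_ge0//.
  by rewrite lee_fin mulr_ge0// fs0// mem_head.
by apply: IH => h hfs; apply: fs0; rewrite inE hfs orbT.
Qed.

(** The expansion takes place in the innermost product: the point carrying [f] is chosen after those
    of [fs], hence [rcons]. The induction only sums [prodx_addr_ge] over the outer labels. *)
Lemma distinct_sum_addr_ge fs f g (t : R) s x :
  {in fs, forall f z, 0 <= f z} -> (forall z, 0 <= f z) -> (forall z, 0 <= g z) ->
  0 <= t -> (forall z, g z + t * f z <= 1) ->
  (distinct_sum fs g s x + t%:E * distinct_sum (rcons fs f) g s x <=
  distinct_sum fs (g \+ (fun z => t * f z))%R s x)%E.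
Proof.
move=> fs0 f0 g0 t0 gtf; have tf0 z : 0 <= t * f z by rewrite mulr_ge0.
have g01 z : 0 <= g z <= 1 by rewrite g0 (le_trans _ (gtf z))// lerDl.
elim: fs fs0 s => [|h fs IH] fs0 s /=.
  rewrite -nneseriesZl//; last first.
    move=> l _; apply: mule_ge0; rewrite lee_fin ?mulr_ge0//.
    by apply: prodx_ge0 => i; exact: g01.
  rewrite [X in (_ + X)%E](_ : _ = \sum_(0 <= l <oo)
    ((l \notin s)%:R * (t * f (x l)) * prodx (rcons s l) (g \o x))%:E)%E.
    by apply: (@prodx_addr_ge _ _ (g \o x) (fun l => t * f (x l))) => l //=.
  by apply: eq_eseriesr => l _; rewrite -!EFinM; congr (_%:E); ring.
have fs0' : {in fs, forall f0 z, 0 <= f0 z}.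
  by move=> k kfs; apply: fs0; rewrite inE kfs orbT.
have h0 z : 0 <= h z by apply: fs0; rewrite mem_head.
have c0 l : (0 <= ((l \notin s)%:R * h (x l))%:E)%E.
  by rewrite lee_fin mulr_ge0.
have W0 l : (0 <= distinct_sum fs g (rcons s l) x)%E.
  exact: distinct_sum_ge0.
have W1 l : (0 <= distinct_sum (rcons fs f) g (rcons s l) x)%E.
  by apply: distinct_sum_ge0 => // k; rewrite mem_rcons inE => /predU1P[->|/fs0'].
rewrite -nneseriesZl//; last by move=> l _; rewrite mule_ge0.
rewrite -nneseriesD//; last 2 first.
  by move=> l _ _; rewrite mule_ge0.
  by move=> l _ _; rewrite !mule_ge0// lee_fin.
apply: lee_nneseries => l _.
  by rewrite adde_ge0// !mule_ge0// lee_fin.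
rewrite muleCA -ge0_muleDr//; last by rewrite mule_ge0// lee_fin.
by apply: lee_wpmul2l => //; exact: IH.
Qed.

(** The correction term is evaluated at the enlarged function. In [mecke] the lemma is applied to g
    - t f, so that the correction term becomes the sum for g itself. *)
Lemma distinct_sum_addr_le fs f g (t : R) s x :
  {in fs, forall f z, 0 <= f z} -> (forall z, 0 <= f z) -> (forall z, 0 <= g z) ->
  0 <= t -> (forall z, g z + t * f z <= 1) ->
  (distinct_sum fs (g \+ (fun z => t * f z))%R s x <=
  distinct_sum fs g s x +
  t%:E * distinct_sum (rcons fs f) (g \+ (fun z => t * f z))%R s x)%E.
Proof.
move=> fs0 f0 g0 t0 gtf; have tf0 z : 0 <= t * f z by rewrite mulr_ge0.
have g01 z : 0 <= g z <= 1 by rewrite g0 (le_trans _ (gtf z))// lerDl.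
set g' := (g \+ _).
have g'01 z : 0 <= g' z <= 1 by rewrite gtf addr_ge0.
elim: fs fs0 s => [|h fs IH] fs0 s /=.
  rewrite -nneseriesZl//; last first.
    move=> l _; apply: mule_ge0; rewrite lee_fin ?mulr_ge0//.
    by apply: prodx_ge0 => i; exact: g'01.
  rewrite [X in (_ + X)%E](_ : _ = \sum_(0 <= l <oo)
    ((l \notin s)%:R * (t * f (x l)) * prodx (rcons s l) (g' \o x))%:E)%E.
    by apply: (@prodx_addr_le _ _ (g \o x) (fun l => t * f (x l))) => l //=.
  by apply: eq_eseriesr => l _; rewrite -!EFinM; congr (_%:E); ring.
have fs0' : {in fs, forall f0 z, 0 <= f0 z}.
  by move=> k kfs; apply: fs0; rewrite inE kfs orbT.
have h0 z : 0 <= h z by apply: fs0; rewrite mem_head.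
have c0 l : (0 <= ((l \notin s)%:R * h (x l))%:E)%E.
  by rewrite lee_fin mulr_ge0.
have W0 l : (0 <= distinct_sum fs g (rcons s l) x)%E.
  exact: distinct_sum_ge0.
have W1 l : (0 <= distinct_sum (rcons fs f) g' (rcons s l) x)%E.
  by apply: distinct_sum_ge0 => // k; rewrite mem_rcons inE => /predU1P[->|/fs0'].
rewrite -nneseriesZl//; last by move=> l _; rewrite mule_ge0.
rewrite -nneseriesD//; last 2 first.
  by move=> l _ _; rewrite mule_ge0.
  by move=> l _ _; rewrite !mule_ge0// lee_fin.
apply: lee_nneseries => l _.
  by rewrite mule_ge0// distinct_sum_ge0.
rewrite muleCA -ge0_muleDr//; last by rewrite mule_ge0// lee_fin.
by apply: lee_wpmul2l => //; exact: IH.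
Qed.

End DistinctSum.

Section MeasurableDistinctSum.
Context (R : realType) (d d' : measure_display).
Context (Omega : measurableType d) (E : measurableType d').
Variable X : nat -> Omega -> E.
Hypothesis mX : forall l, measurable_fun setT (X l).

Lemma measurable_prodx s (g : E -> R) :
  measurable_fun setT g -> (forall z, 0 <= g z <= 1) ->
  measurable_fun setT (fun w => prodx s (g \o X^~ w)).
Proof.
move=> mg g01.
apply: (@measurable_fun_cvg _ _ _ _ (fun L w => prodn s (g \o X^~ w) L)).
  move=> L; under eq_fun do rewrite /prodn -big_filter.
  apply: measurable_prod => l _.
  exact: (measurableT_comp mg (mX l)).
by move=> w _; apply: cvg_prodx => l; exact: g01.
Qed.

Lemma measurable_distinct_sum (fs : seq (E -> R)) (g : E -> R) s :
  {in fs, forall f, measurable_fun setT f} -> {in fs, forall f z, 0 <= f z} ->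
  measurable_fun setT g -> (forall z, 0 <= g z <= 1) ->
  measurable_fun setT (fun w => distinct_sum fs g s (X^~ w)).
Proof.
move=> mfs fs0 mg g01; elim: fs mfs fs0 s => [|f fs IH] mfs fs0 s /=.
  by apply/measurable_EFinP; exact: measurable_prodx.
have fs0' : {in fs, forall f0 z, 0 <= f0 z}.
  by move=> k kfs; apply: fs0; rewrite inE kfs orbT.
apply: ge0_emeasurable_sum => [l w _ _|l _].
  rewrite mule_ge0 ?distinct_sum_ge0// lee_fin mulr_ge0//.
  by apply: fs0; rewrite mem_head.
apply: emeasurable_funM; last first.
  by apply: IH => // k kfs; apply: mfs; rewrite inE kfs orbT.
apply/measurable_EFinP; apply: measurable_funM => //.
by apply: (measurableT_comp _ (mX l)); apply: mfs; rewrite mem_head.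
Qed.

End MeasurableDistinctSum.

(** The passage to t = 0 in [mecke]: after division by t the error is a factor exp (t a). *)
Lemma expR_le_limit (R : realType) (K a t0 y : R) : 0 < t0 ->
  (forall t, 0 < t <= t0 -> y <= K * expR (t * a)) -> y <= K.
Proof.
move=> t00 H.
have cK : K * expR (t * a) @[t --> 0^'+] --> K.
  rewrite [X in _ --> X](_ : _ = K * expR (0 * a)); last by rewrite mul0r expR0 mulr1.
  apply: cvg_at_right_filter; apply: cvgM; first exact: cvg_cst.
  apply: continuous_cvg; first exact: continuous_expR.
  by apply: cvgM; [exact: cvg_id|exact: cvg_cst].
rewrite -(cvg_lim _ cK)//; apply: limr_ge; first by apply/cvg_ex; exists K.
near=> t; apply: H; apply/andP; split; near: t; first exact: nbhs_right_gt.
exact: nbhs_right_le.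
Unshelve. all: by end_near. Qed.

(** * The Mecke formula *)

Section Mecke.
Context (R : realType) (d d' : measure_display).
Context (Omega : measurableType d) (E : measurableType d').
Context (P : probability Omega R) (m : {measure set E -> \bar R}).
Variable X : nat -> Omega -> E.
Hypothesis mX : forall l, measurable_fun setT (X l).
Local Notation mean f := (\int[m]_z (f z)%:E)%E.
Hypothesis laplace : forall g : E -> R, measurable_fun setT g ->
  (forall z, 0 <= g z <= 1) -> (mean (fun z => 1 - g z)%R < +oo)%E ->
  (\int[P]_w (prodx [::] (g \o X^~ w))%:E =
    (expR (- fine (mean (fun z => 1 - g z)%R)))%:E)%E.

Lemma meanD (g f : E -> R) t : measurable_fun setT g -> measurable_fun setT f ->
  (forall z, 0 <= f z) -> 0 <= t -> (forall z, g z + t * f z <= 1) ->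
  (mean (fun z => 1 - g z)%R =
  mean (fun z => 1 - (g z + t * f z))%R + t%:E * mean f)%E.
Proof.
move=> mg mf f0 t0 gtf.
rewrite -ge0_integralZl_EFin//; last 2 first.
  by move=> z _; rewrite lee_fin.
  exact/measurable_EFinP.
rewrite -ge0_integralD//.
- by apply: eq_integral => z _; rewrite -EFinM -EFinD; congr EFin; ring.
- by move=> z _; rewrite lee_fin subr_ge0.
- apply/measurable_EFinP/measurable_funB => //; apply: measurable_funD => //.
  exact: measurable_funM.
- by move=> z _; rewrite -EFinM lee_fin mulr_ge0.
- by apply: measurable_funeM; exact/measurable_EFinP.
Qed.

(* The bound by g keeps g - t f nonnegative, and the bound by 1 - g keeps
   g + t f at most 1, for small t. *)
Lemma mecke (fs : seq (E -> R)) (g : E -> R) C : 0 < C -> measurable_fun setT g ->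
  (forall z, 0 <= g z <= 1) -> (mean (fun z => 1 - g z)%R < +oo)%E ->
  {in fs, forall f : E -> R, measurable_fun setT f} ->
  {in fs, forall (f : E -> R) z, [/\ 0 <= f z, f z <= C * g z & f z <= C * (1 - g z)]} ->
  (\int[P]_w distinct_sum fs g [::] (X^~ w) =
   ((\prod_(f <- fs) fine (mean f)) *
     expR (- fine (mean (fun z => 1 - g z)%R)))%:E)%E.
Proof.
elim/last_ind: fs g C => [|fs f IH] g C C0 mg g01 fing mfs Cfs.
  by rewrite big_nil mul1r -laplace.
have f_in : f \in rcons fs f by rewrite mem_rcons mem_head.
have fs_in h : h \in fs -> h \in rcons fs f.
  by move=> hfs; rewrite mem_rcons inE hfs orbT.
have mf := mfs _ f_in.
have f0 z : 0 <= f z by have [] := Cfs _ f_in z.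
have fCg z : f z <= C * g z by have [] := Cfs _ f_in z.
have fC1g z : f z <= C * (1 - g z) by have [] := Cfs _ f_in z.
have fs0 : {in fs, forall (f : E -> R) z, 0 <= f z}.
  by move=> h /fs_in hfs z; have [] := Cfs _ hfs z.
have g1_ge0 z : 0 <= 1 - g z by rewrite subr_ge0; case/andP: (g01 z).
have mg1 : measurable_fun setT (fun z => 1 - g z) by exact: measurable_funB.
have finf : mean f \is a fin_num.
  rewrite ge0_fin_numE; last by apply: integral_ge0 => z _; rewrite lee_fin.
  apply: (@le_lt_trans _ _ (C%:E * mean (fun z => 1 - g z)%R)%E); last first.
    by rewrite lte_mul_pinfty// ?lee_fin ltW.
  rewrite -ge0_integralZl_EFin//; last 3 first.
    by move=> z _; rewrite lee_fin.
    exact/measurable_EFinP.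
    exact: ltW.
  apply: ge0_le_integral => //.
  - by move=> z _; rewrite lee_fin.
  - exact/measurable_EFinP.
  - by apply: measurable_funeM; exact/measurable_EFinP.
  - by move=> z _; rewrite -EFinM lee_fin.
have fin1g : mean (fun z => 1 - g z)%R \is a fin_num.
  by rewrite ge0_fin_numE//; apply: integral_ge0 => z _; rewrite lee_fin.
set mu := fine (mean f); set I := \prod_(f <- fs) fine (mean f).
set e := fine (mean (fun z => 1 - g z)%R).
have mu0 : 0 <= mu by apply/fine_ge0/integral_ge0 => z _; rewrite lee_fin.
have I0 : 0 <= I.
  rewrite /I big_seq; apply: prodr_ge0 => h hfs; apply: fine_ge0.
  by apply: integral_ge0 => z _; rewrite lee_fin fs0.
have E0 : (\int[P]_w distinct_sum fs g [::] (X^~ w) = (I * expR (- e))%:E)%E.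
  apply: (IH g C) => //; first by move=> h /fs_in; exact: mfs.
  by move=> h /fs_in hfs z; exact: Cfs.
(* For t up to 1 / (2 C), t f is at most half of g and half of 1 - g. Both g + t f and g - t f then
   satisfy the domination hypotheses with 2 C in place of C, so the induction hypothesis applies to
   them. *)
pose t0 : R := (2 * C)^-1.
have t00 : 0 < t0 by rewrite invr_gt0 mulr_gt0.
have tf t z : 0 < t <= t0 -> 0 <= t * f z.
  by move=> /andP[t_gt0 _]; rewrite mulr_ge0// ltW.
have tfle t z : 0 < t <= t0 -> t * f z <= (1 - g z) / 2 /\ t * f z <= g z / 2.
  move=> /andP[t_gt0 tt0]; have t2C : t * C <= 2^-1.
    apply: (@le_trans _ _ (t0 * C)); first by rewrite ler_wpM2r// ltW.
    by rewrite /t0 invfM -mulrA mulVf ?mulr1// gt_eqF.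
  have H k : 0 <= k -> f z <= C * k -> t * f z <= k / 2.
    move=> k0 /(ler_wpM2l (ltW t_gt0))/le_trans; apply.
    by rewrite mulrA [leRHS]mulrC ler_wpM2r.
  by split; apply: H => //; case/andP: (g01 z).
have fs0f : {in rcons fs f, forall (f : E -> R) z, 0 <= f z}.
  by move=> h hfs z; have [] := Cfs _ hfs z.
have mfs' : {in fs, forall f : E -> R, measurable_fun setT f}.
  by move=> h /fs_in; exact: mfs.
have mW' : measurable_fun setT (fun w => distinct_sum (rcons fs f) g [::] (X^~ w)).
  exact: measurable_distinct_sum.
have W'0 w : (0 <= distinct_sum (rcons fs f) g [::] (X^~ w))%E.
  exact: distinct_sum_ge0.
have mWfs (g' : E -> R) : measurable_fun setT g' -> (forall z, 0 <= g' z <= 1) ->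
    measurable_fun setT (fun w => distinct_sum fs g' [::] (X^~ w)).
  by move=> mg' g'01; exact: measurable_distinct_sum.
have Wfs0 (g' : E -> R) w : (forall z, 0 <= g' z <= 1) ->
    (0 <= distinct_sum fs g' [::] (X^~ w))%E.
  by move=> g'01; exact: distinct_sum_ge0.
set W' := (\int[P]_w distinct_sum (rcons fs f) g [::] (X^~ w))%E.
have W'_ge0 : (0 <= W')%E by exact: integral_ge0.
(* The induction hypothesis at g + t f, together with the lower expansion of its sum, bounds [W']
   from above. *)
have upper t : 0 < t <= t0 ->
    ((I * expR (- e))%:E + t%:E * W' <= (I * expR (- e + t * mu))%:E)%E.
  move=> tt0; have [t_gt0 _] := andP tt0.
  pose gp : E -> R := g \+ (fun z => t * f z).
  have gp1 z : g z + t * f z <= 1.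
    by have [+ _] := tfle t z tt0; have := g1_ge0 z; lra.
  have mgp : measurable_fun setT gp.
    by apply: measurable_funD => //; exact: measurable_funM.
  have gp01 z : 0 <= gp z <= 1.
    by rewrite gp1 andbT addr_ge0 ?(tf _ _ tt0)//; case/andP: (g01 z).
  have De : mean (fun z => 1 - g z)%R =
      (mean (fun z => 1 - gp z)%R + t%:E * mean f)%E.
    by apply: meanD => //; exact: ltW.
  have tmf : (0 <= t%:E * mean f)%E.
    by rewrite mule_ge0 ?integral_ge0// ?lee_fin ?ltW// => z _; rewrite lee_fin.
  have fingp : mean (fun z => 1 - gp z)%R \is a fin_num.
    rewrite ge0_fin_numE; last first.
      by apply: integral_ge0 => z _; rewrite lee_fin subr_ge0; case/andP: (gp01 z).
    by apply: le_lt_trans fing; rewrite De leeDl.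
  have egp : fine (mean (fun z => 1 - gp z)%R) = e - t * mu.
    apply/eqP; rewrite eq_sym subr_eq; apply/eqP.
    by rewrite /e De fineD ?fineM ?fin_numM.
  have Egp : (\int[P]_w distinct_sum fs gp [::] (X^~ w) =
      (I * expR (- e + t * mu))%:E)%E.
    rewrite (IH gp (2 * C))//.
    - by rewrite egp opprB addrC.
    - by rewrite mulr_gt0.
    - by rewrite ltey_eq fingp.
    move=> h /fs_in /Cfs hz z; have [h0 hCg hC1g] := hz z; split => //.
      apply: (le_trans hCg); rewrite -mulrA mulrCA ler_wpM2l//; first exact: ltW.
      have := tf _ z tt0; have /andP[] := g01 z.
      by rewrite /gp/=; lra.
    apply: (le_trans hC1g); rewrite -mulrA mulrCA ler_wpM2l//; first exact: ltW.
    by have [+ _] := tfle t z tt0; rewrite /gp/=; lra.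
  rewrite -E0 -Egp -ge0_integralZl_EFin//; last exact: ltW.
  rewrite -ge0_integralD//; last 4 first.
    - by move=> w _; exact: Wfs0.
    - exact: mWfs.
    - by move=> w _; rewrite mule_ge0// lee_fin ltW.
    - exact: measurable_funeM.
  apply: ge0_le_integral => //.
  - by move=> w _; rewrite adde_ge0 ?Wfs0// mule_ge0// lee_fin ltW.
  - by apply: emeasurable_funD; [exact: mWfs|exact: measurable_funeM].
  - exact: mWfs.
  - move=> w _; apply: distinct_sum_addr_ge => //; last exact: ltW.
    by move=> z; case/andP: (g01 z).
(* The induction hypothesis at g - t f; writing g as (g - t f) + t f, the upper expansion bounds
   [W'] from below. *)
have lower t : 0 < t <= t0 ->
    ((I * expR (- e))%:E <= (I * expR (- e - t * mu))%:E + t%:E * W')%E.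
  move=> tt0; have [t_gt0 _] := andP tt0.
  pose gm : E -> R := fun z => g z - t * f z.
  have gmE : g = (gm \+ (fun z => t * f z)).
    by apply/funext => z; rewrite /gm/= subrK.
  have gm0 z : 0 <= gm z.
    by have [_] := tfle t z tt0; have /andP[+ _] := g01 z; rewrite /gm; lra.
  have mgm : measurable_fun setT gm.
    by apply: measurable_funB => //; exact: measurable_funM.
  have gmg z : gm z <= g z by rewrite /gm gerBl (tf _ _ tt0).
  have gm01 z : 0 <= gm z <= 1.
    by rewrite gm0 (le_trans (gmg z))//; case/andP: (g01 z).
  have gmtf z : gm z + t * f z <= 1.
    by rewrite /gm subrK; case/andP: (g01 z).
  have De : mean (fun z => 1 - gm z)%R =
      (mean (fun z => 1 - g z)%R + t%:E * mean f)%E.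
    rewrite [LHS](@meanD gm f t)//; last exact: ltW.
    by congr (_ + _)%E; apply: eq_integral => z _; rewrite /gm subrK.
  have egm : fine (mean (fun z => 1 - gm z)%R) = e + t * mu.
    by rewrite /e De fineD ?fineM ?fin_numM.
  have Egm : (\int[P]_w distinct_sum fs gm [::] (X^~ w) =
      (I * expR (- e - t * mu))%:E)%E.
    rewrite (IH gm (2 * C))//.
    - by rewrite egm opprD.
    - by rewrite mulr_gt0.
    - by rewrite ltey_eq De fin_numD fin1g fin_numM.
    move=> h /fs_in /Cfs hz z; have [h0 hCg hC1g] := hz z; split => //.
      apply: (le_trans hCg); rewrite -mulrA mulrCA ler_wpM2l//; first exact: ltW.
      by have [_] := tfle t z tt0; have /andP[+ _] := g01 z; rewrite /gm; lra.
    apply: (le_trans hC1g); rewrite -mulrA mulrCA ler_wpM2l//; first exact: ltW.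
    by have := gmg z; have /andP[] := g01 z; lra.
  rewrite -E0 -Egm -ge0_integralZl_EFin//; last exact: ltW.
  rewrite -ge0_integralD//; last 4 first.
    - by move=> w _; exact: Wfs0.
    - exact: mWfs.
    - by move=> w _; rewrite mule_ge0// lee_fin ltW.
    - exact: measurable_funeM.
  apply: ge0_le_integral => //.
  - by move=> w _; exact: Wfs0.
  - exact: mWfs.
  - apply: emeasurable_funD; first exact: mWfs.
    exact: measurable_funeM.
  - move=> w _; rewrite [in leLHS]gmE [in X in (_ + _ * X)%E]gmE.
    by apply: distinct_sum_addr_le => //; exact: ltW.
have t0t0 : 0 < t0 <= t0 by rewrite t00/=.
(* Already the single bound [upper t0] excludes +oo. *)
have W'fin : W' \is a fin_num.
  rewrite ge0_fin_numE// ltNge leye_eq; apply/eqP => W'y.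
  by have := upper _ t0t0; rewrite W'y gt0_muley ?lte_fin.
rewrite big_rcons/= -/mu -(fineK W'fin); congr EFin.
rewrite -(fineK W'fin) in upper lower.
set y := fine W' in upper lower *.
have Iemu0 : 0 <= I * expR (- e) * mu by rewrite !mulr_ge0// expR_ge0.
suff [h1 h2] : y <= I * expR (- e) * mu /\ - y <= - (I * expR (- e) * mu).
  by apply/eqP; rewrite mulrAC eq_le h1 -lerN2 h2.
split.
  apply: (@expR_le_limit _ _ mu t0) => // t tt0; have [t_gt0 _] := andP tt0.
  have := upper t tt0; rewrite -EFinM -EFinD lee_fin expRD.
  set K := I * expR (- e); rewrite mulrA => H.
  have K0 : 0 <= K by rewrite mulr_ge0// expR_ge0.
  rewrite -(ler_pM2l t_gt0).
  (* Multiplied by exp (t mu), this reads exp (t mu) - 1 <= t mu exp (t mu). It turns [upper] into y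
     <= K mu exp (t mu), the form required by [expR_le_limit]. *)
  have : 1 - t * mu <= expR (- (t * mu)).
    by have := expR_ge1Dx (- (t * mu)).
  move=> /(ler_wpM2r (mulr_ge0 K0 (expR_ge0 (t * mu)))).
  rewrite [leRHS]mulrCA -expRD addNr expR0 mulr1 => H2.
  have -> : t * (K * mu * expR (t * mu)) = t * mu * (K * expR (t * mu)) by ring.
  by move: H H2; rewrite -/K; lra.
apply: (@expR_le_limit _ _ (- mu) t0) => // t tt0; have [t_gt0 _] := andP tt0.
have := lower t tt0; rewrite -EFinM -EFinD lee_fin expRD.
set K := I * expR (- e); rewrite mulrA => H.
have K0 : 0 <= K by rewrite mulr_ge0// expR_ge0.
rewrite -(ler_pM2l t_gt0).
have : 1 + t * mu <= expR (t * mu) by exact: expR_ge1Dx.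
move=> /(ler_wpM2r (mulr_ge0 K0 (expR_ge0 (- (t * mu))))).
rewrite [leRHS]mulrCA -expRD subrr expR0 mulr1 => H2.
rewrite (mulrN t mu).
have -> : t * (- (K * mu) * expR (- (t * mu))) =
  - (t * mu * (K * expR (- (t * mu)))) by ring.
by move: H H2; rewrite -/K; lra.
Qed.

End Mecke.

Lemma integral_mul_indic (d : measure_display) (T : measurableType d)
  (R : realType) (mu : {measure set T -> \bar R}) (D A : set T) (f : T -> \bar R) :
  (\int[mu]_(x in D) (f x * (\1_A x)%:E) = \int[mu]_(x in D `&` A) f x)%E.
Proof.
by rewrite integral_mkcondr; under [RHS]eq_integral do rewrite epatch_indic.
Qed.

Lemma ge0_nneseriesZl (R : realType) (f : nat -> \bar R) (x : \bar R) :
  (0 <= x)%E -> (forall n, 0 <= f n)%E ->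
  (\sum_(0 <= n <oo) (x * f n) = x * \sum_(0 <= n <oo) f n)%E.
Proof.
case: x => [x| |] // x0 f0; first by rewrite nneseriesZl.
have [f00|] := pselect (forall n, f n = 0%E).
  by rewrite !eseries0 ?mule0// => n _ _; rewrite f00 mule0.
move=> /existsNP[n /eqP fn0].
have fn : (0 < f n)%E by rewrite lt0e fn0 f0.
rewrite (@nneseries_pinfty _ (fun n => +oo * f n)%E xpredT n)//.
- rewrite gt0_mulye//; apply: lt_le_trans fn _.
  rewrite (@nneseriesD1 _ _ n)//.
  by rewrite leeDl// nneseries_ge0.
- by move=> k _; rewrite mule_ge0.
- by rewrite gt0_mulye.
Qed.

(** * The Laplace functional of a Poisson point process *)

Section PointCount.
Context (R : realType) (E : Type).

(** Only [k] of the points lie in [A], so the partial products are eventually constant. *)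
Lemma cvg_prodn_count (A : set E) (x : nat -> E) (v : R) (k : nat) :
  (\sum_(0 <= l <oo) (\1_A (x l))%:E = (k%:R : R)%:E)%E ->
  prodn [::] (fun l => 1 - v * \1_A (x l)) @ \oo --> (1 - v) ^+ k.
Proof.
move=> xk; pose c L := (\sum_(0 <= l < L) (x l \in A))%N.
have prodE L : prodn [::] (fun l => 1 - v * \1_A (x l)) L = (1 - v) ^+ c L.
  elim: L => [|L IH]; first by rewrite prodn0 /c big_geq.
  rewrite prodnS/= IH /c big_nat_recr//= exprD indicE.
  by case: (x L \in A); rewrite ?(mulr1, mulr0, subr0, expr0, expr1).
have sumE L : (\sum_(0 <= l < L) (\1_A (x l))%:E = ((c L)%:R : R)%:E)%E.
  by rewrite sumEFin natr_sum; congr EFin; apply: eq_bigr => l _; rewrite indicE.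
have ind0 l : (0 <= (\1_A (x l) : R)%:E)%E by rewrite lee_fin.
have ck L : (c L <= k)%N.
  rewrite -(ler_nat R) -lee_fin -sumE -xk.
  exact: nneseries_lim_ge.
have [L0 kL0] : exists L0, (k <= c L0)%N.
  apply: contrapT => /forallNP H.
  have : (\sum_(0 <= l <oo) (\1_A (x l))%:E <= (k.-1%:R : R)%:E)%E.
    apply: lime_le; first exact: is_cvg_nneseries.
    apply: nearW => L; rewrite sumE lee_fin ler_nat.
    by have /negP := H L; rewrite -ltnNge; case: k {xk ck H}.
  rewrite xk lee_fin ler_nat => kk1; apply: (H 0).
  by move: kk1; case: (k) => //= k'; rewrite ltnn.
apply: cvg_near_cst; apply: filterS (nbhs_infty_ge L0) => L L0L.
rewrite prodE; congr (_ ^+ _); apply/eqP; rewrite eqn_leq ck/=.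
apply: (leq_trans kL0); rewrite /c (@big_cat_nat _ _ _ L0 0 L)//=.
exact: leq_addr.
Qed.

End PointCount.

Section AtNat.
Context (R : realType).
Local Open Scope ereal_scope.

(** Zero off the natural numbers, in particular at +oo. The series of indicators reduces its
    integrals to probabilities of events, which is the form in which independence is given. *)
Definition at_nat (c : nat -> R) (y : \bar R) : \bar R :=
  \sum_(0 <= n <oo) (c n)%:E * (\1_([set n%:R%:E] : set (\bar R)) y)%:E.

Lemma at_nat_ge0 c y : (forall n, 0 <= c n)%R -> 0 <= at_nat c y.
Proof. by move=> c0; apply: nneseries_ge0 => n _ _; rewrite mule_ge0// lee_fin. Qed.

Lemma at_natE c k : (forall n, 0 <= c n)%R -> at_nat c k%:R%:E = (c k)%:E.
Proof.
move=> c0; rewrite /at_nat (@nneseriesD1 _ _ k)//; last first.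
  by move=> n _; rewrite mule_ge0// lee_fin.
rewrite indicE mem_set//= mule1 eseries0 ?adde0// => n _ /= nk.
rewrite indicE memNset ?mule0//= => /eqP.
by rewrite eqe eqr_nat eq_sym (negbTE nk).
Qed.

Lemma measurable_at_nat c : (forall n, 0 <= c n)%R -> measurable_fun setT (at_nat c).
Proof.
move=> c0; apply: ge0_emeasurable_sum => [n w _ _|n _].
  by rewrite mule_ge0// lee_fin.
apply: measurable_funeM; apply/measurable_EFinP; apply: measurable_indic.
exact: emeasurable_set1.
Qed.

End AtNat.

Section IndependentProduct.
Context (d : measure_display) (Omega : measurableType d) (R : realType).
Context (P : probability Omega R) (Y : nat -> Omega -> \bar R).
Hypothesis mY : forall i, measurable_fun setT (Y i).
Hypothesis indepY : mutually_independent P Y.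
Variable c : nat -> nat -> R.
Hypothesis c0 : forall i n, 0 <= c i n.
Local Open Scope ereal_scope.

Lemma measurable_prod_at_nat J :
  measurable_fun setT (fun w => \prod_(i <- J) at_nat (c i) (Y i w)).
Proof.
elim: J => [|i J IH].
  by under eq_fun do rewrite big_nil; exact: measurable_cst.
under eq_fun do rewrite big_cons.
apply: emeasurable_funM => //.
exact: (measurableT_comp (measurable_at_nat (c0 i)) (mY i)).
Qed.

(** Indices in [J1] still carry a function, those in [J2] already an event. Each induction step
    expands one function into indicators and moves its index from [J1] to [J2], until [indepY]
    applies. *)
Lemma integral_prod_independent J1 J2 (B : nat -> set (\bar R)) :
  uniq (J1 ++ J2) -> (forall i, measurable (B i)) ->
  \int[P]_(w in \bigcap_(i in [set` J2]) Y i @^-1` B i)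
    \prod_(i <- J1) at_nat (c i) (Y i w) =
  \prod_(i <- J1) (\sum_(0 <= n <oo) (c i n)%:E * P (Y i @^-1` [set n%:R%:E])) *
  \prod_(i <- J2) P (Y i @^-1` B i).
Proof.
have mD (J : seq nat) B' : (forall i, measurable (B' i)) ->
    measurable (\bigcap_(i in [set` J]) Y i @^-1` B' i).
  move=> mB; apply: bigcap_measurableType => // i _.
  by rewrite -[X in measurable X]setTI; exact: mY.
elim: J1 J2 B => [|i J1 IH] J2 B.
  move=> /= uJ mB; under eq_integral do rewrite big_nil.
  by rewrite integral_cst ?mul1e ?big_nil ?mul1e//; [exact: indepY|exact: mD].
rewrite /= mem_cat negb_or => /andP[/andP[iJ1 iJ2] uJ] mB.
have P0 w : 0 <= \prod_(i <- J1) at_nat (c i) (Y i w).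
  by apply: prode_ge0 => // k _; exact: at_nat_ge0.
set D := \bigcap_(i in _) _; have mDB : measurable D by exact: mD.
have mYn n : measurable (Y i @^-1` [set n%:R%:E]).
  by rewrite -[X in measurable X]setTI; apply: mY => //; exact: emeasurable_set1.
transitivity (\int[P]_(w in D) (\sum_(0 <= n <oo)
    (c i n)%:E * (\prod_(i <- J1) at_nat (c i) (Y i w) * (\1_(Y i @^-1` [set n%:R%:E]) w)%:E))).
  apply: eq_integral => w _; rewrite big_cons muleC -ge0_nneseriesZl//.
    by apply: eq_eseriesr => n _; rewrite muleCA.
  by move=> n; rewrite mule_ge0// lee_fin.
rewrite integral_nneseries//; last 2 first.
  - move=> n; apply: measurable_funeM; apply: emeasurable_funM.
      by apply: measurable_funTS; exact: measurable_prod_at_nat.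
    by apply/measurable_EFinP; exact: measurable_indic.
  - by move=> n w _; rewrite !mule_ge0// lee_fin.
set A1 := \prod_(i <- J1) _ in IH *.
set A2 := \prod_(i <- J2) _.
have A20 : 0 <= A2 by apply: prode_ge0 => k _; exact: measure_ge0.
have A10 : 0 <= A1.
  by apply: prode_ge0 => k _; apply: nneseries_ge0 => n _ _; rewrite mule_ge0// lee_fin.
rewrite big_cons -/A1 -muleA [RHS]muleC -ge0_nneseriesZl//; last 2 first.
  by rewrite mule_ge0.
  by move=> n; rewrite mule_ge0// lee_fin.
apply: eq_eseriesr => n _.
rewrite ge0_integralZl_EFin//; last 2 first.
  - by move=> w _; rewrite mule_ge0// lee_fin.
  - apply: emeasurable_funM.
      by apply: measurable_funTS; exact: measurable_prod_at_nat.
    by apply/measurable_EFinP; exact: measurable_indic.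
rewrite muleCA; congr (_ * _).
rewrite integral_mul_indic.
pose B' k := if k == i then [set n%:R%:E] else B k.
have mB' k : measurable (B' k).
  by rewrite /B'; case: ifP => // _; exact: emeasurable_set1.
have -> : D `&` Y i @^-1` [set n%:R%:E] =
    \bigcap_(k in [set` (i :: J2)]) Y k @^-1` B' k.
  apply/seteqP; split => w /=.
    move=> [Dw Yw] k /=; rewrite inE => /predU1P[->|kJ2].
      by rewrite /B' eqxx.
    by rewrite /B'; case: eqVneq => [->//|_]; exact: Dw.
  move=> H; split.
    move=> k /= kJ2; have := H k; rewrite /= inE kJ2 orbT => /(_ isT).
    by rewrite /B'; case: eqVneq kJ2 => // ->; rewrite (negbTE iJ2).
  by have := H i; rewrite /= inE eqxx /B' eqxx => /(_ isT).
rewrite (IH _ B')//; last by rewrite uniq_catC cat_cons/= mem_cat negb_or iJ1 iJ2 uniq_catC.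
rewrite big_cons /B' eqxx -/A1 -muleA; congr (_ * _).
rewrite [RHS]muleC; congr (_ * _).
rewrite /A2 big_seq [RHS]big_seq; apply: eq_bigr => k kJ2.
by case: eqVneq kJ2 => // ->; rewrite (negbTE iJ2).
Qed.

End IndependentProduct.

Section PoissonLaw.
Context (d : measure_display) (Omega : measurableType d) (R : realType).
Context (P : probability Omega R).

Lemma poisson_pgf (N : Omega -> \bar R) (M q : R) : 0 <= M -> 0 <= q ->
  has_poisson_law P N M%:E ->
  (\sum_(0 <= n <oo) (q ^+ n)%:E * P (N @^-1` [set n%:R%:E]) =
  (expR (- ((1 - q) * M)))%:E)%E.
Proof.
move=> M0 q0; rewrite /has_poisson_law/= => NP.
under eq_eseriesr do rewrite NP.
(* For mean 0, [poisson_prob] is the Dirac mass at 0 and has to be treated apart from the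
   density. *)
move: M0; rewrite le_eqVlt => /predU1P[<-|M0].
  rewrite mulr0 oppr0 expR0 (@nneseriesD1 _ _ 0)//; last first.
    by move=> n _; rewrite mule_ge0// lee_fin exprn_ge0.
  rewrite expr0 mul1e /poisson_prob ltxx diracE mem_set// eseries0 ?adde0//.
  move=> n _ /= n0; rewrite diracE memNset ?mule0//= => n00.
  by rewrite -n00 eqxx in n0.
have E n : ((q ^+ n)%:E * poisson_prob M 0 [set n] =
    (expR (- M))%:E * (exp_coeff (q * M) n)%:E)%E.
  rewrite /poisson_prob M0 esum_set1; last by rewrite lee_fin poisson_pmf_ge0.
  rewrite /poisson_pmf M0 -!EFinM /exp_coeff/= exprMn; congr EFin.
  by rewrite [in RHS]mulrC !mulrA.
under eq_eseriesr do rewrite E.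
rewrite nneseriesZl; last first.
  by move=> n _; rewrite lee_fin divr_ge0// exprn_ge0// mulr_ge0// ltW.
have -> : (\sum_(0 <= n <oo) (exp_coeff (q * M) n)%:E = (expR (q * M))%:E)%E.
  rewrite /expR -EFin_lim; last exact: is_cvg_series_exp_coeff.
  by apply/congr_lim/funext => n/=; rewrite /series/= -sumEFin.
by rewrite -EFinM -expRD; congr (expR _)%:E; ring.
Qed.

(** The generating function at q = 1 says that the masses of the natural numbers add up to 1, so
    nothing is left for +oo. *)
Lemma poisson_ae_nat (N : Omega -> \bar R) (M : R) : 0 <= M ->
  measurable_fun setT N ->
  has_poisson_law P N M%:E ->
  {ae P, forall w, exists k : nat, N w = k%:R%:E}.
Proof.
move=> M0 mN NP.
have mNn n : measurable (N @^-1` [set n%:R%:E]).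
  by rewrite -[X in measurable X]setTI; apply: mN => //; exact: emeasurable_set1.
have tN : trivIset setT (fun n => N @^-1` [set n%:R%:E]).
  move=> i j _ _ [w [/= ->]] /eqP.
  by rewrite eqe eqr_nat => /eqP.
have P1 : P (\bigcup_n (N @^-1` [set n%:R%:E])) = 1%E.
  rewrite measure_bigcup//.
  have := poisson_pgf M0 ler01 NP.
  rewrite subrr mul0r oppr0 expR0 => <-.
  by apply/congr_lim/funext => n; apply: eq_big => [i|i _]; rewrite ?in_setT// expr1n mul1e.
exists (~` \bigcup_n (N @^-1` [set n%:R%:E])); split.
- by apply: measurableC; exact: bigcup_measurable.
- rewrite probability_setC; last exact: bigcup_measurable.
  by rewrite P1 subee.
- by move=> w /= H [n _ /= Nn]; apply: H; exists n.
Qed.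

Lemma measurable_point_count (d' : measure_display) (E : measurableType d')
    (X : nat -> {RV P >-> E}) (B : set E) : measurable B ->
  measurable_fun setT (point_count R X B : Omega -> \bar R).
Proof.
move=> mB; apply: ge0_emeasurable_sum => [n w _ _|n _]; first by rewrite lee_fin.
apply/measurable_EFinP.
by apply: (measurableT_comp _ (@measurable_funPT _ _ _ _ (X n))); exact: measurable_indic.
Qed.

(** Almost surely the infinite product over the points is the product over i of 1 - v_i raised to
    the number of points in A_i. These numbers are independent Poisson variables, so their
    generating functions multiply. *)
Lemma laplace_step (d' : measure_display) (E : measurableType d')
    (X : nat -> {RV P >-> E}) (m : {measure set E -> \bar R})
    (v : nat -> R) (A : nat -> set E) K :
  poisson_point_process X m ->
  (forall i, 0 <= v i <= 1) -> (forall i, measurable (A i)) ->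
  trivIset setT A -> (forall i, (m (A i) < +oo)%E) ->
  (\int[P]_w (prodx [::] (fun l => \prod_(0 <= i < K) (1 - v i * \1_(A i) (X l w)))%R)%:E
  = (expR (- \sum_(0 <= i < K) (v i * fine (m (A i)))))%:E)%E.
Proof.
move=> [Xlaw Xindep] v01 mA tA finA.
have finmA i : m (A i) = (fine (m (A i)))%:E by rewrite fineK// ge0_fin_numE.
have mA0 i : 0 <= fine (m (A i)) by rewrite fine_ge0.
have law i : has_poisson_law P (point_count R X (A i)) (fine (m (A i)))%:E.
  by rewrite -finmA; exact: Xlaw.
have v1 i : 0 <= 1 - v i by rewrite subr_ge0; case/andP: (v01 i).
have mY i : measurable_fun setT (point_count R X (A i) : Omega -> \bar R).
  exact: measurable_point_count.
have := @integral_prod_independent _ _ _ _ (fun i => point_count R X (A i)) mY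
  (Xindep A mA tA) (fun i n => (1 - v i) ^+ n)
  (fun i n => exprn_ge0 n (v1 i)) (index_iota 0 K) [::] (fun=> setT).
rewrite cats0 iota_uniq set_nil bigcap_set0 big_nil mule1 => /(_ isT).
move=> /(_ (fun=> measurableT)).
under [X in _ = X -> _]eq_bigr => i _ do rewrite (poisson_pgf (mA0 i) (v1 i) (law i)).
rewrite prodEFin -expR_sum => H.
have -> : - (\sum_(0 <= i < K) v i * fine (m (A i))) =
    \sum_(i <- index_iota 0 K) - ((1 - (1 - v i)) * fine (m (A i))).
  by rewrite -sumrN; apply: eq_bigr => i _; rewrite subKr.
have g01 i z : 0 <= 1 - v i * \1_(A i) z <= 1.
  have /andP[vi0 vi1] := v01 i; rewrite indicE.
  by case: (z \in A i); rewrite ?(mulr1, mulr0) ?subr0 ?ler01 ?lexx// v1 gerBl.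
pose g z := \prod_(0 <= i < K) (1 - v i * \1_(A i) z).
have mg : measurable_fun setT g.
  apply: measurable_prod => i _; apply: measurable_funB => //.
  by apply: measurable_funM => //; exact: measurable_indic.
have g'01 z : 0 <= g z <= 1.
  apply/andP; split; first by apply: prodr_ge0 => i _; case/andP: (g01 i z).
  by apply: prodr_ile1 => i _; exact: g01.
have c0 i n : 0 <= (1 - v i) ^+ n by exact: exprn_ge0.
rewrite -H; apply: ge0_ae_eq_integral => //.
- by apply/measurable_EFinP; apply: (@measurable_prodx _ _ _ _ _ X _ _ g).
- exact: (@measurable_prod_at_nat _ _ _ (fun i => point_count R X (A i)) mY _ c0).
- by move=> w _; rewrite lee_fin; apply: prodx_ge0 => l; exact: g'01.
- by move=> w _; apply: prode_ge0 => i _; exact: at_nat_ge0.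
have Nnat : {ae P, forall w, forall i, exists k : nat,
    point_count R X (A i) w = k%:R%:E}.
  apply: ae_foralln => i.
  exact: (poisson_ae_nat (mA0 i) (mY i) (law i)).
apply: filterS Nnat => w /choice[k Nk] _.
under eq_bigr do rewrite Nk at_natE//.
rewrite prodEFin; congr EFin; apply: cvg_lim => //.
have -> : prodn [::] (fun l => \prod_(0 <= i < K) (1 - v i * \1_(A i) (X l w))) =
    (fun L => \prod_(i <- index_iota 0 K)
       prodn [::] (fun l => 1 - v i * \1_(A i) (X l w)) L).
  by apply/funext => L; rewrite /prodn exchange_big.
apply: cvg_big => [|i _]; first exact: mul_continuous.
by apply: cvg_prodn_count; exact: Nk.
Qed.

End PoissonLaw.

Lemma ler_prodx (R : realType) s (a b : nat -> R) :
  (forall l, 0 <= a l) -> (forall l, a l <= b l) -> (forall l, b l <= 1) ->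
  prodx s a <= prodx s b.
Proof.
move=> a0 ab b1.
have b01 l : 0 <= b l <= 1 by rewrite b1 (le_trans (a0 l)).
have a01 l : 0 <= a l <= 1 by rewrite a0 (le_trans (ab l)).
apply: ler_lim; [exact: cvg_prodx|exact: cvg_prodx|].
by apply: nearW => L; apply: ler_prod => l _; rewrite a0 ab.
Qed.

(** Convergence from above matters here: an infinite product is the infimum of its partial products,
    which yields the upper estimate, while b <= a n yields the lower one. *)
Lemma cvg_prodx_seq (R : realType) s (a : nat -> nat -> R) (b : nat -> R) :
  (forall l, 0 <= b l) -> (forall n l, b l <= a n l) -> (forall n l, a n l <= 1) ->
  (forall l, a n l @[n --> \oo] --> b l) ->
  prodx s (a n) @[n --> \oo] --> prodx s b.
Proof.
move=> b0 ba a1 cab.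
have a01 n l : 0 <= a n l <= 1 by rewrite a1 (le_trans (b0 l)).
have b01 l : 0 <= b l <= 1 by rewrite b0 (le_trans (ba 0%N l)).
apply/cvgrPdist_lt => e e0.
have e20 : 0 < e / 2 by rewrite divr_gt0.
have /cvgrPdist_lt/(_ _ e20)[L _ /(_ L (leqnn _))/= HL] := @cvg_prodx _ s _ b01.
have : prodn s (a n) L @[n --> \oo] --> prodn s b L.
  apply: cvg_big => [|l _]; [exact: mul_continuous|exact: cab].
move=> /cvgrPdist_lt/(_ _ e20); apply: filterS => n Hn.
have h1 := @prodx_le _ s _ (a01 n) L.
have h2 : prodx s b <= prodx s (a n) by apply: ler_prodx.
rewrite distrC ger0_norm ?subr_ge0//.
have := ler_norm (prodn s b L - prodx s b); rewrite distrC in HL.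
have := ler_norm (prodn s (a n) L - prodn s b L); rewrite distrC in Hn.
by move: HL Hn h1; lra.
Qed.

Import HBNNSimple.

Section NonnegSimple.
Context (R : realType) (d : measure_display) (E : measurableType d).

Lemma prod_trivIset (v : nat -> R) (A : nat -> set E) K z :
  trivIset setT A ->
  \prod_(0 <= i < K) (1 - v i * \1_(A i) z) =
  1 - \sum_(0 <= i < K) v i * \1_(A i) z.
Proof.
move=> tA; elim: K => [|K IH]; first by rewrite !big_geq// subr0.
rewrite !big_nat_recr//= IH.
suff : (\sum_(0 <= i < K) v i * \1_(A i) z) * (v K * \1_(A K) z) = 0 by lra.
rewrite big_distrl/= big_nat big1// => i iK.
rewrite !indicE; case: (boolP (z \in A i)) => zi; last by rewrite mulr0 mul0r.
rewrite memNset ?mulr0// => zK; have := tA i K I I.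
rewrite inE in zi => /(_ (ex_intro _ z (conj zi zK))) iK'.
by rewrite iK' ltnn andbF in iK.
Qed.

(** The value 0 is dropped, so that every level set of an integrable [h] has finite measure. The
    level sets are continued by the empty set to a disjoint sequence, as the independence clause of
    [poisson_point_process] expects. *)
Lemma nnsfun_stepE (h : {nnsfun E >-> R}) : exists K (v : nat -> R) (A : nat -> set E),
  [/\ (forall i, (i < K)%N -> 0 < v i /\ exists z, v i = h z),
      (forall i, measurable (A i)), trivIset setT A,
      (forall i, (K <= i)%N -> v i = 0 /\ A i = set0) &
      forall z, h z = \sum_(0 <= i < K) v i * \1_(A i) z].
Proof.
have /finite_seqP[r rE] : finite_set (range h) by exact: fimfunP.
pose vs : seq R := undup [seq v <- r | v != 0].
have in_r v : v \in r <-> range h v by rewrite rE.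
pose A i := if (i < size vs)%N then h @^-1` [set vs`_i] else set0.
have uvs : uniq vs by exact: undup_uniq.
have in_vs v : v \in vs -> v != 0 /\ exists z, v = h z.
  rewrite mem_undup mem_filter => /andP[v0 /in_r[z _ vz]].
  by split => //; exists z.
exists (size vs), (fun i => vs`_i), A; split.
- move=> i iK; have [v0 [z vz]] := in_vs _ (mem_nth 0 iK).
  by split; [rewrite lt0r v0 vz/=; exact: fun_ge0|exists z].
- by move=> i; rewrite /A; case: ifP => // _; exact: measurable_sfunP.
- move=> i j _ _ [z []]; rewrite /A; case: ifP => // iK; case: ifP => // jK /= hi hj.
  by apply/eqP; rewrite -(nth_uniq 0 iK jK uvs) -hi -hj.
- move=> i Ki; split; first exact: nth_default.
  by rewrite /A ltnNge Ki.
- move=> z; have [hz0|hz0] := eqVneq (h z) 0.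
    rewrite hz0 big_nat big1// => i /andP[_ iK].
    rewrite indicE memNset ?mulr0// /A iK/= hz0 => e.
    by have [] := in_vs _ (mem_nth 0 iK); rewrite -e eqxx.
  have hzin : h z \in vs.
    by rewrite mem_undup mem_filter hz0; apply/in_r; exists z.
  have iK : (index (h z) vs < size vs)%N by rewrite index_mem.
  rewrite big_mkord (bigD1 (Ordinal iK))//= nth_index// indicE mem_set; last first.
    by rewrite /A iK/= nth_index.
  rewrite mulr1 big1 ?addr0// => i ni; rewrite indicE memNset ?mulr0//.
  rewrite /A ltn_ord/= => e; move/negP: ni; apply; apply/eqP/val_inj => /=.
  by apply/eqP; rewrite -(nth_uniq 0 _ _ uvs)// nth_index// e.
Qed.

End NonnegSimple.

Section LaplaceFunctional.
Context (d : measure_display) (Omega : measurableType d) (R : realType).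
Context (P : probability Omega R).
Context (d' : measure_display) (E : measurableType d').
Context (X : nat -> {RV P >-> E}) (m : {measure set E -> \bar R}).
Hypothesis ppp : poisson_point_process X m.

Lemma laplace_nnsfun (h : {nnsfun E >-> R}) : (forall z, h z <= 1) ->
  (\int[m]_z (h z)%:E < +oo)%E ->
  (\int[P]_w (prodx [::] (fun l => 1 - h (X l w)))%:E =
    (expR (- fine (\int[m]_z (h z)%:E)))%:E)%E.
Proof.
move=> h1 hfin; have [K [v [A [v0 mA tA A0 hE]]]] := nnsfun_stepE h.
have v01 i : 0 <= v i <= 1.
  have [iK|/A0[-> _]] := ltnP i K; last by rewrite lexx ler01.
  by have [/ltW -> [z ->]] := v0 i iK; rewrite h1.
have vA0 i z : 0 <= v i * \1_(A i) z.
  by rewrite mulr_ge0//; case/andP: (v01 i).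
have mv i : measurable_fun setT (fun z => (v i * \1_(A i) z)%:E).
  by apply/measurable_EFinP; apply: measurable_funM.
have intE : (\int[m]_z (h z)%:E = \sum_(0 <= i < K) (v i)%:E * m (A i))%E.
  under eq_integral do rewrite hE -sumEFin.
  rewrite ge0_integral_sum//; last by move=> i z _; rewrite lee_fin.
  apply: eq_bigr => i _; under eq_integral do rewrite EFinM.
  rewrite ge0_integralZl_EFin//; last 2 first.
  - by apply/measurable_EFinP; exact: measurable_indic.
  - by case/andP: (v01 i).
  by rewrite integral_indic// setIT.
have finA i : (m (A i) < +oo)%E.
  have [iK|Ki] := ltnP i K; last by rewrite (A0 i Ki).2 measure0.
  have : ((v i)%:E * m (A i) <= \int[m]_z (h z)%:E)%E.
    rewrite intE big_mkord (bigD1 (Ordinal iK))//= leeDl//.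
    apply: sume_ge0 => k _; rewrite mule_ge0// lee_fin.
    by case/andP: (v01 k).
  move=> /le_lt_trans/(_ hfin); apply: contraTT; rewrite -!leNgt !leye_eq => /eqP ->.
  by rewrite gt0_muley// lte_fin; have [] := v0 i iK.
have {}intE : (\int[m]_z (h z)%:E = (\sum_(0 <= i < K) v i * fine (m (A i)))%:E)%E.
  rewrite intE -sumEFin; apply: eq_bigr => i _.
  by rewrite EFinM fineK// ge0_fin_numE.
rewrite intE/= -(laplace_step K ppp v01 mA tA finA).
apply: eq_integral => w _; congr (prodx _ _)%:E; apply/funext => l.
by rewrite prod_trivIset// -hE.
Qed.

(** Simple functions increase to 1 - g, hence approximate g from above, as [cvg_prodx_seq] requires.
    The exponent converges by monotone convergence, the expectation by dominated convergence with
    bound 1. *)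
Lemma laplace_functional (g : E -> R) : measurable_fun setT g ->
  (forall z, 0 <= g z <= 1) -> (\int[m]_z (1 - g z)%:E < +oo)%E ->
  (\int[P]_w (prodx [::] (g \o X^~ w))%:E =
    (expR (- fine (\int[m]_z (1 - g z)%:E)))%:E)%E.
Proof.
move=> mg g01 gfin; pose h z := (1 - g z)%:E.
have mh : measurable_fun setT h.
  by apply/measurable_EFinP; exact: measurable_funB.
have h0 z : setT z -> (0 <= h z)%E.
  by move=> _; rewrite lee_fin subr_ge0; case/andP: (g01 z).
pose hn := nnsfun_approx measurableT mh.
have cvgh z : hn n z @[n --> \oo] --> 1 - g z.
  by have /fine_cvgP[] := cvg_nnsfun_approx measurableT mh h0 (I : setT z).
have ndh z : nondecreasing_seq (hn ^~ z).
  by move=> i j ij; exact/(lefP _ _ (nd_nnsfun_approx measurableT mh ij)).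
have hnle n z : hn n z <= 1 - g z.
  rewrite -(cvg_lim _ (cvgh z))//; apply: nondecreasing_cvgn_le => //.
  by apply/cvg_ex; eexists; exact: cvgh.
have hn0 n z : 0 <= hn n z by exact: fun_ge0.
have hn1 n z : hn n z <= 1.
  by apply: (le_trans (hnle n z)); rewrite gerBl; case/andP: (g01 z).
have mhn n : measurable_fun setT (fun z => (hn n z)%:E).
  exact/measurable_EFinP.
have cvgI : (\int[m]_z (hn n z)%:E @[n --> \oo] --> \int[m]_z h z)%E.
  have -> : (\int[m]_z h z = \int[m]_z limn (fun n => (hn n z)%:E))%E.
    apply: eq_integral => z _; apply/esym/cvg_lim => //.
    exact: (cvg_nnsfun_approx measurableT mh h0 I).
  apply: cvg_monotone_convergence => //.
  - by move=> n z _; rewrite lee_fin.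
  - by move=> z _ i j ij; rewrite lee_fin; exact: ndh.
have Ihn n : (\int[m]_z (hn n z)%:E <= \int[m]_z h z)%E.
  apply: ge0_le_integral => //.
  - by move=> z _; rewrite lee_fin.
  - by move=> z _; rewrite lee_fin.
have hfin n : (\int[m]_z (hn n z)%:E < +oo)%E by exact: le_lt_trans (Ihn n) gfin.
have Ifin : (\int[m]_z h z)%E \is a fin_num.
  by rewrite ge0_fin_numE// integral_ge0.
have c1 : ((expR (- fine (\int[m]_z (hn n z)%:E)%E))%:E @[n --> \oo] -->
    (expR (- fine (\int[m]_z h z)))%:E)%E.
  apply/fine_cvgP; split; first by apply: nearW.
  apply: continuous_cvg; first exact: continuous_expR.
  by apply: cvgN; apply: fine_cvg; rewrite fineK.
have c2 : (\int[P]_w (prodx [::] (fun l => 1 - hn n (X l w)))%:E @[n --> \oo] -->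
    \int[P]_w (prodx [::] (g \o X^~ w))%:E)%E.
  apply: (@dominated_cvg _ _ _ _ _ _ _ _ (cst 1%E)) => //.
  - move=> n; apply/measurable_EFinP.
    apply: (@measurable_prodx _ _ _ _ _ X _ _ (fun z => 1 - hn n z)) => //.
      exact: measurable_funB.
    by move=> z; rewrite subr_ge0 hn1 gerBl hn0.
  - move=> w _; apply/fine_cvgP; split; first by apply: nearW.
    apply: cvg_prodx_seq => [l|n l|n l|l] /=.
    + by case/andP: (g01 (X l w)).
    + by have := hnle n (X l w); lra.
    + by rewrite gerBl.
    + have : 1 - hn n (X l w) @[n --> \oo] --> 1 - (1 - g (X l w)).
        by apply: cvgB; [exact: cvg_cst|exact: cvgh].
      by rewrite subKr.
  - exact: finite_measure_integrable_cst.
  - move=> n w _; rewrite /= lee_fin ger0_norm; first apply: prodx_le1.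
      by move=> l; rewrite subr_ge0 hn1 gerBl hn0.
    by apply: prodx_ge0 => l; rewrite subr_ge0 hn1 gerBl hn0.
apply: (cvg_unique _ c2); first exact: ereal_hausdorff.
rewrite /=; move: c1; apply: cvg_trans; apply: near_eq_cvg; apply: nearW => n.
by rewrite laplace_nnsfun.
Qed.

End LaplaceFunctional.

(** * The intensity of the beta process *)

Section WeightedIntegral.
Context (R : realType) (d d' : measure_display).
Context (T : measurableType d) (S : measurableType d').
Context (mu : {measure set T -> \bar R}) (nu : {measure set S -> \bar R}).
Variables (D : set S) (p : S -> T) (u : S -> R).
Hypotheses (mD : measurable D) (mp : measurable_fun D p) (mu' : measurable_fun D u).
Hypothesis u0 : forall y, D y -> 0 <= u y.
Hypothesis muE : forall A, measurable A ->
  (mu A = \int[nu]_(y in D) (\1_A (p y) * u y)%:E)%E.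

Lemma integral_nnsfun_weighted (h : {nnsfun T >-> R}) :
  (\int[mu]_x (h x)%:E = \int[nu]_(y in D) (h (p y) * u y)%:E)%E.
Proof.
have [K [v [A [v0 mA tA A0 hE]]]] := nnsfun_stepE h.
have v_ge0 i : 0 <= v i.
  by have [/v0[/ltW]|/A0[-> _]] := ltnP i K.
have mind i : measurable_fun D (fun y => \1_(A i) (p y) * u y).
  apply: measurable_funM => //.
  by apply: (measurableT_comp _ mp); exact: measurable_indic.
under eq_integral do rewrite hE -sumEFin.
under [RHS]eq_integral do rewrite hE big_distrl/= -sumEFin.
rewrite !ge0_integral_sum//; last 4 first.
- move=> i; apply/measurable_EFinP.
  by under eq_fun do rewrite -mulrA; exact: measurable_funM.
- by move=> i y Dy; rewrite lee_fin !mulr_ge0// u0.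
- by move=> i; apply/measurable_EFinP/measurable_funM.
- by move=> i x _; rewrite lee_fin mulr_ge0.
apply: eq_bigr => i _.
under eq_integral do rewrite EFinM.
under [RHS]eq_integral do rewrite -mulrA EFinM.
rewrite !ge0_integralZl_EFin//; last 3 first.
- by move=> y Dy; rewrite lee_fin mulr_ge0// u0.
- exact/measurable_EFinP.
- by apply/measurable_EFinP; exact: measurable_indic.
by rewrite integral_indic// setIT muE.
Qed.

(** Here [mu] is the image under [p] of the measure with density [u] with respect to [nu] on [D].
    The lemma serves twice: for the Levy measure as a marginal of the intensity, and for its density
    with respect to Lebesgue measure. *)
Lemma ge0_integral_weighted (f : T -> R) : measurable_fun setT f ->
  (forall x, 0 <= f x) ->
  (\int[mu]_x (f x)%:E = \int[nu]_(y in D) (f (p y) * u y)%:E)%E.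
Proof.
move=> mf f0.
have mf' : measurable_fun setT (EFin \o f) by exact/measurable_EFinP.
have f0' z : setT z -> (0 <= (EFin \o f) z)%E by move=> _; rewrite lee_fin.
pose hn := nnsfun_approx measurableT mf'.
have cvgh z : hn n z @[n --> \oo] --> f z.
  by have /fine_cvgP[] := cvg_nnsfun_approx measurableT mf' f0' (I : setT z).
have ndh z : nondecreasing_seq (hn ^~ z).
  by move=> i j ij; exact/(lefP _ _ (nd_nnsfun_approx measurableT mf' ij)).
have hn0 n z : 0 <= hn n z by exact: fun_ge0.
transitivity (limn (fun n => \int[mu]_x (hn n x)%:E)%E).
  rewrite -monotone_convergence//.
  - apply: eq_integral => z _; apply/esym/cvg_lim => //.
    exact: (cvg_nnsfun_approx measurableT mf' f0' I).
  - by move=> n; exact/measurable_EFinP.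
  - by move=> n z _; rewrite lee_fin.
  - by move=> z _ i j ij; rewrite lee_fin; exact: ndh.
under eq_fun do rewrite integral_nnsfun_weighted.
rewrite -monotone_convergence//.
- apply: eq_integral => y /set_mem Dy; apply/cvg_lim => //.
  apply/fine_cvgP; split; first by apply: nearW.
  by apply: cvgM; [exact: cvgh|exact: cvg_cst].
- move=> n; apply/measurable_EFinP; apply: measurable_funM => //.
  exact: measurableT_comp.
- by move=> n y Dy; rewrite lee_fin mulr_ge0// u0.
- by move=> y Dy i j ij; rewrite lee_fin ler_wpM2r// ?u0//; exact: ndh.
Qed.

End WeightedIntegral.

Section BetaIntegral.
Context (R : realType).
Local Notation leb := (@lebesgue_measure R).

Lemma is_derive_onem_powR (a x : R) : x < 1 -> a != 0 ->
  is_derive x 1 (fun x => - ((1 - x) `^ a / a)) ((1 - x) `^ (a - 1)).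
Proof.
move=> x1 a0; have x1' : 0 < 1 - x by rewrite subr_gt0.
have d1 : is_derive x 1 (fun x : R => 1 - x) (- 1).
  rewrite -[X in is_derive _ _ _ X]sub0r.
  exact: (is_deriveB (is_derive_cst (1 : R) x 1) (is_derive_id x 1)).
have d2 := is_derive1_powR a x1'.
have := @is_derive1_comp _ (@powR R ^~ a) (fun x : R => 1 - x) x _ _ d2 d1.
move=> d3.
have -> : (fun x : R => - ((1 - x) `^ a / a)) =
    (- a^-1) \*: ((@powR R ^~ a) \o (fun x : R => 1 - x)).
  by apply/funext => y; rewrite /= scaleNr /GRing.scale/= mulrC.
apply: is_derive_eq; rewrite /GRing.scale/=.
by rewrite mulrN1 mulrNN mulrA mulVf// mul1r.
Qed.

(** The interval stops at r < 1 because the integrand is unbounded near 1 when a < 1. *)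
Lemma integral_onem_powR_itv (a r : R) : 0 < a -> 0 < r < 1 ->
  (\int[leb]_(x in `[0%R, r]) ((1 - x) `^ (a - 1))%:E =
   ((1 - (1 - r) `^ a) / a)%:E)%E.
Proof.
move=> a0 /andP[r0 r1]; have an0 : a != 0 by rewrite gt_eqF.
pose F (x : R) : R := - ((1 - x) `^ a / a).
have cF (x : R) : x < 1 -> {for x, continuous F}.
  move=> x1; apply: differentiable_continuous; apply/derivable1_diffP.
  by case: (is_derive_onem_powR x1 an0).
pose f (x : R) : R := (1 - x) `^ (a - 1).
rewrite (@continuous_FTC2 _ f F)//.
- by rewrite /F subr0 powR1 -EFinB; congr EFin; field.
- apply: continuous_in_subspaceT => x; rewrite inE/= in_itv/= => /andP[_ xr].
  have x1 := le_lt_trans xr r1; have x1' : 0 < 1 - x by rewrite subr_gt0.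
  apply: (@continuous_comp _ _ _ (fun x : R => 1 - x) (@powR R ^~ (a - 1))).
    by apply: cvgB; [exact: cvg_cst|exact: cvg_id].
  apply: differentiable_continuous; apply/derivable1_diffP.
  by case: (is_derive1_powR (a - 1) x1').
- split.
  + move=> x; rewrite in_itv/= => /andP[_ xr].
    by case: (is_derive_onem_powR (lt_trans xr r1) an0).
  + by apply: cvg_at_right_filter; exact: cF.
  + by apply: cvg_at_left_filter; exact: cF.
- move=> x; rewrite in_itv/= => /andP[_ xr].
  by rewrite derive1E; case: (is_derive_onem_powR (lt_trans xr r1) an0).
Qed.

Lemma measurable_onem_powR (D : set (measurableTypeR R)) (a : R) :
  measurable_fun D (fun x => ((1 - x) `^ (a - 1))%:E).
Proof.
apply/measurable_EFinP; apply: measurable_funTS.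
apply: (measurableT_comp (measurable_powR _)).
exact: measurable_funB.
Qed.

Lemma integral_onem_powR (a : R) : 0 < a ->
  (\int[leb]_(x in `]0%R, 1%R[) ((1 - x) `^ (a - 1))%:E = (a^-1)%:E)%E.
Proof.
move=> a0.
(* The shift by 2 makes [r 0] positive, so that [integral_onem_powR_itv] applies to every [r n]. *)
pose r n : R := 1 - n.+2%:R^-1.
have r01 n : 0 < r n < 1.
  by rewrite subr_gt0 invf_lt1 ?ltr0n// ltr1n/= gtrBl invr_gt0.
rewrite (@integral_itv_obnd_cbnd); last exact: measurable_onem_powR.
have -> : [set` `[0%R, 1%R[ ] = \bigcup_n ([set` `[0%R, r n] ] : set R).
  apply/seteqP; split => x /=; rewrite ?in_itv/=.
    move=> /andP[x0 x1]; have x1' : 0 < 1 - x by rewrite subr_gt0.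
    exists (Num.truncn (1 - x)^-1) => //=; rewrite in_itv/= x0/= lerBrDr addrC -lerBrDr.
    rewrite invf_ple ?posrE ?ltr0n//.
    apply: (@le_trans _ _ (Num.truncn (1 - x)^-1).+1%:R).
      by apply/ltW; rewrite truncnS_gt.
    by rewrite ler_nat.
  move=> [n _ /=]; rewrite in_itv/= => /andP[-> /le_lt_trans]; apply.
  by case/andP: (r01 n).
apply/esym; apply: (cvg_unique (@ereal_hausdorff R) _
  (ge0_nondecreasing_set_cvg_integral _ _ _ _)).
rewrite /=; under eq_fun do rewrite integral_onem_powR_itv//.
apply/fine_cvgP; split; first by apply: nearW.
rewrite -[X in _ --> X]mul1r; apply: cvgM; last exact: cvg_cst.
rewrite -[X in _ --> X]subr0; apply: cvgB; first exact: cvg_cst.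
have /cvg_at_rightP := powR_cvg0 a0; apply; split.
  by move=> n; rewrite /r subKr invr_gt0.
rewrite /r; under eq_fun do rewrite subKr.
have := @cvg_harmonic R; rewrite -(cvg_shiftS (@harmonic R)); exact.
- move=> i j ij; rewrite subsetEset => x /=; rewrite !in_itv/= => /andP[-> /le_trans]; apply.
  by rewrite lerB// lef_pV2 ?posrE ?ltr0n// ler_nat.
- by move=> n; exact: measurable_itv.
- by move=> n; exact: measurable_onem_powR.
- by move=> n x _; rewrite lee_fin powR_ge0.
Qed.

Lemma beta_lawE (a : R) (B : set R) : 0 < a ->
  (beta_law 1 a B =
    a%:E * \int[leb]_(x in B `&` `]0%R, 1%R[) ((1 - x) `^ (a - 1))%:E)%E.
Proof.
move=> a0; rewrite /beta_law.
under eq_integral do rewrite subrr powRr0 mul1r.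
under [X in (_ * (fine X)^-1%:E)%E]eq_integral do rewrite subrr powRr0 mul1r.
by rewrite integral_onem_powR// invrK muleC.
Qed.

End BetaIntegral.

Section JumpIntensity.
Context (R : realType) (gamma theta : R).
Hypotheses (gamma_gt0 : 0 < gamma) (theta_gt0 : 0 < theta).
Local Notation leb := (@lebesgue_measure R).
Local Notation E := (measurableTypeR R * measurableTypeR R)%type.
Local Notation levy := (beta_process_levy gamma_gt0 theta_gt0).
Local Notation intensity := (jump_intensity levy).

Lemma measurable_snd_itv : measurable ([set z | 0 <= z.2 <= 1] : set E).
Proof.
have -> : [set z : E | 0 <= z.2 <= 1] = snd @^-1` [set` `[0, 1]].
  by apply/seteqP; split => z /=; rewrite in_itv.
by rewrite -[X in measurable X]setTI; apply: measurable_snd => //; exact: measurable_itv.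
Qed.

Definition unit_loc (z : E) : R := \1_([set z : E | 0 <= z.2 <= 1]) z.

Lemma measurable_unit_loc : measurable_fun setT unit_loc.
Proof. by apply: measurable_indic; exact: measurable_snd_itv. Qed.

Lemma intensityX (A B : set (measurableTypeR R)) : measurable A -> measurable B ->
  B `<=` [set` `[0, +oo[ ] ->
  (intensity (A `*` B) = levy A * leb B)%E.
Proof.
move=> mA mB B0; rewrite -product_measure1E//.
rewrite /jump_intensity/= /mrestr; congr (product_measure1 _ _ _).
by apply/seteqP; split => [z []//|z [Az Bz]]; split => //; split => //; exact: B0.
Qed.

Lemma measurable_beta_process_density :
  measurable_fun ([set` `]0%R, 1%R[ ] : set (measurableTypeR R))
    (beta_process_density gamma theta).
Proof.
apply: measurable_funM; last first.
  apply: (measurableT_comp (measurable_powR _)).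
  exact: measurable_funB.
apply: measurable_funM => //.
apply: open_continuous_measurable_fun; first exact: interval_open.
move=> x; rewrite inE/= in_itv/= => /andP[x0 _].
by apply: inv_continuous; rewrite gt_eqF.
Qed.

(** The locations used fill an interval of length 1, so integrating them out leaves exactly the Levy
    measure. *)
Lemma integral_intensity (f : R -> R) : measurable_fun setT f ->
  (forall x, 0 <= f x) ->
  (\int[intensity]_z (f z.1 * unit_loc z)%:E =
   \int[leb]_(x in `]0%R, 1%R[) (f x * beta_process_density gamma theta x)%:E)%E.
Proof.
move=> mf f0.
rewrite -(@ge0_integral_weighted _ _ _ _ _ levy intensity setT fst unit_loc)//; last 2 first.
- exact: measurable_unit_loc.
- move=> A mA.
  transitivity (intensity (A `*` [set` `[0%R, 1%R]])).
    rewrite intensityX//; last first.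
      by move=> x /=; rewrite !in_itv/= => /andP[->].
    by rewrite lebesgue_measure_itv/= lte_fin ltr01 sube0 mule1.
  rewrite -[X in intensity X]setIT -integral_indic//; last first.
    by apply: measurableX => //; exact: measurable_itv.
  apply: eq_integral => z _; rewrite /unit_loc !indicE -natrM mulnb.
  congr (_ %:R)%:E; congr nat_of_bool.
  apply/idP/andP => [/set_mem[/= Az]|[/set_mem Az /set_mem/= z2]].
    by rewrite in_itv/= => z2; split; rewrite inE.
  by apply/mem_set; split; rewrite //= in_itv.
apply: (@ge0_integral_weighted _ _ _ _ _ levy leb [set` `]0%R, 1%R[ ] idfun) => //.
- exact: measurable_id.
- exact: measurable_beta_process_density.
- move=> x /=; rewrite in_itv/= => /andP[x0 x1].
  by rewrite /beta_process_density !mulr_ge0 ?powR_ge0 ?invr_ge0// ltW.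
- move=> A mA; rewrite /= /beta_process_levy setIC -integral_mul_indic.
  by apply: eq_integral => x _; rewrite -EFinM mulrC.
Qed.

(** The probability that a jump of size x first appears in round j, counted from 0, restricted to
    sizes in [B]. The indicator of []0, 1[] makes it nonnegative on all of [R]. *)
Definition appear_weight (j : nat) (B : set R) (x : R) : R :=
  \1_(B `&` [set` `]0%R, 1%R[ ]) x * (x * (1 - x) ^+ j).

Lemma appear_weight_ge0 j B x : 0 <= appear_weight j B x.
Proof.
rewrite /appear_weight indicE; case: (boolP (x \in _)) => [|_]; last by rewrite mul0r.
move=> /set_mem[_ /=]; rewrite in_itv/= => /andP[x0 x1].
by rewrite mul1r mulr_ge0 ?exprn_ge0 ?subr_ge0 ?ltW.
Qed.

Lemma measurable_appear_weight j (B : set (measurableTypeR R)) : measurable B ->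
  measurable_fun setT (appear_weight j B).
Proof.
move=> mB; apply: measurable_funM.
  by apply: measurable_indic; apply: measurableI => //; exact: measurable_itv.
apply: measurable_funM => //; apply: measurable_funX.
exact: measurable_funB.
Qed.

Lemma integral_appear_weight j (B : set (measurableTypeR R)) : measurable B ->
  (\int[intensity]_z (appear_weight j B z.1 * unit_loc z)%:E =
   (gamma * theta / (theta + j%:R))%:E * beta_law 1 (theta + j%:R) B)%E.
Proof.
move=> mB; have tj : 0 < theta + j%:R by rewrite ltr_wpDr.
rewrite integral_intensity; last 2 first.
- exact: measurable_appear_weight.
- by move=> x; exact: appear_weight_ge0.
rewrite beta_lawE// muleA -EFinM divfK ?gt_eqF//.
rewrite -ge0_integralZl_EFin//; last 4 first.
- by apply: measurableI => //; exact: measurable_itv.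
- by move=> x _; rewrite lee_fin powR_ge0.
- exact: measurable_onem_powR.
- by rewrite mulr_ge0// ltW.
rewrite [RHS]integral_mkcondl; apply: eq_integral => x.
rewrite inE/= in_itv/= => /andP[x0 x1].
rewrite patchE /appear_weight indicE /beta_process_density.
rewrite in_setI [X in _ && X]mem_set ?andbT; last by rewrite /= in_itv/= x0.
case: (x \in B); last by rewrite !mul0r.
rewrite mul1r -EFinM; congr EFin.
have x1' : 0 < 1 - x by rewrite subr_gt0.
rewrite (_ : theta + j%:R - 1 = (theta - 1) + j%:R); last by ring.
rewrite [in RHS]powRD; last by rewrite (gt_eqF x1') implybT.
rewrite powR_mulrn ?ltW//.
by field; rewrite gt_eqF.
Qed.

End JumpIntensity.

Section BetaProcessMecke.
Context (R : realType) (gamma theta : R).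
Hypotheses (gamma_gt0 : 0 < gamma) (theta_gt0 : 0 < theta).
Context (d : measure_display) (Omega : measurableType d).
Context (P : probability Omega R).
Local Notation leb := (@lebesgue_measure R).
Local Notation E := (measurableTypeR R * measurableTypeR R)%type.
Local Notation levy := (beta_process_levy gamma_gt0 theta_gt0).
Local Notation intensity := (jump_intensity levy).
Context (jump : nat -> {RV P >-> E}).
Hypothesis ppp : poisson_point_process jump intensity.

Definition stick_rate (j : nat) : R := gamma * theta / (theta + j%:R).

Lemma stick_rate_gt0 j : 0 < stick_rate j.
Proof. by rewrite /stick_rate divr_gt0 ?mulr_gt0// ltr_wpDr. Qed.

Lemma beta_lawT (a : R) : 0 < a -> beta_law 1 a setT = 1%E.
Proof.
by move=> a0; rewrite beta_lawE// setTI integral_onem_powR// -EFinM divff ?gt_eqF.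
Qed.

Lemma beta_law_ge0 (a : R) (B : set R) : 0 < a -> (0 <= beta_law 1 a B)%E.
Proof.
move=> a0; rewrite beta_lawE//; apply: mule_ge0; first by rewrite lee_fin ltW.
by apply: integral_ge0 => x _; rewrite lee_fin powR_ge0.
Qed.

Lemma beta_law_le1 (a : R) (B : set (measurableTypeR R)) : 0 < a -> measurable B ->
  (beta_law 1 a B <= 1)%E.
Proof.
move=> a0 mB; rewrite -(beta_lawT a0) !beta_lawE// lee_wpmul2l//.
  by rewrite lee_fin ltW.
apply: ge0_subset_integral => //.
- by apply: measurableI => //; exact: measurable_itv.
- by rewrite setTI; exact: measurable_itv.
- exact: measurable_onem_powR.
- by move=> x _; rewrite lee_fin powR_ge0.
- by move=> x [_].
Qed.

Lemma beta_law_fin_num (a : R) (B : set (measurableTypeR R)) : 0 < a ->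
  measurable B -> beta_law 1 a B \is a fin_num.
Proof.
move=> a0 mB; rewrite ge0_fin_numE ?beta_law_ge0//.
by apply: (le_lt_trans (beta_law_le1 a0 mB)); rewrite ltry.
Qed.

Definition weight j (B : set R) (z : E) : R := appear_weight j B z.1 * unit_loc z.

(* The probability (1 - x)^N that a jump of size x located in [0, 1] does not
   appear in the first N rounds. *)
Definition skip_weight (N : nat) (z : E) : R :=
  1 - \1_([set` `]0%R, 1%R[ ] : set R) z.1 * (1 - (1 - z.1) ^+ N) * unit_loc z.

Lemma sum_appear_weight N x : \sum_(0 <= j < N) appear_weight j setT x =
  \1_([set` `]0%R, 1%R[ ] : set R) x * (1 - (1 - x) ^+ N).
Proof.
elim: N => [|N IH]; first by rewrite big_geq// expr0 subrr mulr0.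
rewrite big_nat_recr//= IH /appear_weight setTI exprS.
by ring.
Qed.

Lemma skip_weightE N z :
  1 - skip_weight N z = \sum_(0 <= j < N) weight j setT z.
Proof. by rewrite /weight -big_distrl/= sum_appear_weight /skip_weight subKr. Qed.

Lemma unit_loc01 z : (unit_loc z == 0 :> R) || (unit_loc z == 1 :> R).
Proof. by rewrite /unit_loc indicE; case: (z \in _); rewrite eqxx ?orbT. Qed.

Lemma skip_weight01 N z : 0 <= skip_weight N z <= 1.
Proof.
rewrite /skip_weight indicE; case: (boolP (z.1 \in _)) => [|_]; last first.
  by rewrite !mul0r subr0 ler01 lexx.
move=> /set_mem/=; rewrite in_itv/= => /andP[x0 x1].
have h : 0 <= (1 - z.1) ^+ N <= 1.
  by apply/andP; split; [apply: exprn_ge0; lra|apply: exprn_ile1; lra].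
by have /orP[/eqP->|/eqP->] := unit_loc01 z; lra.
Qed.

Lemma measurable_weight j (B : set (measurableTypeR R)) : measurable B ->
  measurable_fun setT (weight j B).
Proof.
move=> mB; apply: measurable_funM; last exact: measurable_unit_loc.
by apply: (measurableT_comp (measurable_appear_weight j mB)); exact: measurable_fst.
Qed.

Lemma measurable_skip_weight N : measurable_fun setT (skip_weight N).
Proof.
rewrite (_ : skip_weight N = fun z =>
    1 - \sum_(0 <= j < N) weight j setT z); last first.
  by apply/funext => z; rewrite -skip_weightE subKr.
apply: measurable_funB => //; apply: measurable_sum => j _.
exact: measurable_weight.
Qed.

Lemma weight_ge0 j B (z : E) : 0 <= weight j B z.
Proof. by rewrite mulr_ge0 ?appear_weight_ge0// /unit_loc. Qed.

Lemma integral_skip_weight N :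
  (\int[intensity]_z (1 - skip_weight N z)%:E =
   (\sum_(0 <= j < N) stick_rate j)%:E)%E.
Proof.
under eq_integral do rewrite skip_weightE -sumEFin.
rewrite ge0_integral_sum//; last 2 first.
- by move=> j; apply/measurable_EFinP; exact: measurable_weight.
- by move=> j z _; rewrite lee_fin weight_ge0.
rewrite -sumEFin; apply: eq_bigr => j _.
by rewrite integral_appear_weight// beta_lawT ?mule1// ltr_wpDr.
Qed.

(* The bound q < 1 on the sizes makes x (1 - x)^r at most a constant times
   (1 - x)^N, as the Mecke formula requires. *)
Lemma distinct_sum_beta_process N n (r : nat -> nat)
    (B : nat -> set (measurableTypeR R)) (q : R) :
  (forall i, (i < n)%N -> (r i < N)%N) -> (forall i, measurable (B i)) ->
  q < 1 -> (forall i x, B i x -> x <= q) ->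
  (\int[P]_w distinct_sum
      [seq weight (r i) (B i) | i <- iota 0 n]
      (skip_weight N) [::] (jump ^~ w) =
   (\prod_(i <- iota 0 n)
      (stick_rate (r i) * fine (beta_law 1 (theta + (r i)%:R) (B i))) *
    expR (- \sum_(0 <= j < N) stick_rate j))%:E)%E.
Proof.
move=> rN mB q1 Bq.
(* The power (1 - q)^-N serves the bound by g, which is (1 - x)^N >= (1 - q)^N for locations in
   [0, 1]. The value 1 serves the bound by 1 - g, where the weight of round [r i] is one of the
   summands. *)
pose C : R := Num.max 1 ((1 - q) ^- N).
have C1 : 1 <= C by rewrite le_max lexx.
have C0 : 0 < C by exact: lt_le_trans C1.
rewrite (@mecke _ _ _ _ _ P intensity jump _ _ _ _ C)//.
- rewrite integral_skip_weight/= big_map; congr (_ * _)%:E.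
  apply: eq_bigr => i _; rewrite integral_appear_weight//.
  by rewrite fineM// beta_law_fin_num// ltr_wpDr.
- by move=> g mg g01 gfin; exact: laplace_functional.
- exact: measurable_skip_weight.
- by move=> z; exact: skip_weight01.
- by rewrite integral_skip_weight ltry.
- by move=> f /mapP[i _ ->]; exact: measurable_weight.
move=> f /mapP[i]; rewrite mem_iota/= add0n => iN -> z; split.
- exact: weight_ge0.
- have [zB|zB] := boolP (z.1 \in B i `&` [set` `]0%R, 1%R[ ]); last first.
    rewrite /weight /appear_weight indicE (negbTE zB) !mul0r mulr_ge0//; first exact: ltW.
    by case/andP: (skip_weight01 N z).
  move/set_mem: (zB) => [/Bq zq /=]; rewrite in_itv/= => /andP[z0 z1].
  have -> : skip_weight N z = 1 - (1 - (1 - z.1) ^+ N) * unit_loc z.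
    by rewrite /skip_weight indicE mem_set ?mul1r//= in_itv/= z0.
  rewrite /weight /appear_weight indicE zB mul1r.
  have w1 : z.1 * (1 - z.1) ^+ r i <= 1.
    rewrite mulr_ile1 ?exprn_ge0 ?exprn_ile1//; lra.
  have w0 : 0 <= z.1 * (1 - z.1) ^+ r i by rewrite mulr_ge0 ?exprn_ge0//; lra.
  have /orP[/eqP->|/eqP->] := unit_loc01 z.
    by rewrite !mulr0 subr0 mulr1 ltW.
  rewrite !mulr1 subKr; apply: (le_trans w1).
  apply: (@le_trans _ _ ((1 - q) ^- N * (1 - z.1) ^+ N)).
    rewrite ler_pdivlMl ?exprn_gt0 ?subr_gt0// mulr1.
    by rewrite lerXn2r ?nnegrE ?subr_ge0 ?(ltW q1) ?(ltW z1)// lerB.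
  by rewrite ler_wpM2r ?exprn_ge0 ?subr_ge0 ?(ltW z1)// /C le_max lexx orbT.
- rewrite skip_weightE; apply: (@le_trans _ _ (weight (r i) setT z)).
    apply: ler_wpM2r; first by rewrite /unit_loc indicE.
    rewrite /appear_weight !indicE setTI in_setI.
    case: (boolP (z.1 \in [set` `]0%R, 1%R[ ])) => [|_]; last by rewrite andbF !mul0r.
    move=> /set_mem/=; rewrite in_itv/= => /andP[z0 z1]; rewrite andbT.
    have w0 : 0 <= z.1 * (1 - z.1) ^+ r i by rewrite mulr_ge0 ?exprn_ge0//; lra.
    by case: (z.1 \in B i); rewrite ?mul0r ?mul1r.
  rewrite -[leLHS]mul1r; apply: ler_pM => //; first exact: weight_ge0.
  rewrite big_mkord (bigD1 (Ordinal (rN i iN)))//= lerDl.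
  by apply: sumr_ge0 => k _; exact: weight_ge0.
Qed.

(** Sizes outside []0, 1[] have intensity 0 (an infinite length of locations times 0), so their
    number is Poisson with mean 0. Hence the inclusion probabilities almost surely lie in [0, 1]. *)
Lemma jump_size01 : {ae P, forall w, forall l, 0 < (jump l w).1 < 1}.
Proof.
have [law _] := ppp.
pose A0 : set R := ~` [set` `]0%R, 1%R[ ]; pose A : set E := A0 `*` setT.
have mA0 : measurable (A0 : set (measurableTypeR R)).
  by apply: measurableC; exact: measurable_itv.
have mA : measurable A by exact: measurableX.
have A00 : intensity A = 0%E.
  rewrite /jump_intensity/= /mrestr.
  have -> : A `&` setT `*` [set` `[0%R, +oo[ ] = A0 `*` [set` `[0%R, +oo[ ].
    by apply/seteqP; split => [z [[Az _] [_]]|z [Az z2]].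
  rewrite product_measure1E//= /beta_process_levy.
  by rewrite setICl integral_set0 mul0e.
have := law A mA; rewrite A00 /has_poisson_law/= => /(_ 0%N).
rewrite /poisson_prob ltxx diracE mem_set//= => PN.
have mN : measurable [set w | point_count R jump A w = 0%E].
  rewrite -[X in measurable X]setTI.
  exact: (measurable_point_count jump mA measurableT (emeasurable_set1 _)).
exists (~` [set w | point_count R jump A w = 0%E]); split.
- exact: measurableC.
- by rewrite probability_setC ?PN ?subee.
move=> w /= H; apply: contra_not H => Nw l.
apply: contrapT => /negP lw.
have Alw : A (jump l w) by split => //; rewrite /A0/= in_itv/=; exact/negP.
have : (1%:E <= point_count R jump A w)%E.
  rewrite /point_count (@nneseriesD1 _ _ l)//.
  by rewrite indicE mem_set// leeDl// nneseries_ge0.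
by rewrite Nw lee_fin ler10.
Qed.

End BetaProcessMecke.

(** * The first rounds *)

Section Rounds.
Variable b : seq (seq nat).
Hypothesis ub : uniq (flatten b).

(** A label in none of the lists gets the default [size b] of [find], which forces all its draws in
    the first rounds to be false. *)
Definition round_of (l : nat) : nat := find (fun s => l \in s) b.

Lemma nth_flatten_inj l j j' : l \in nth [::] b j -> l \in nth [::] b j' -> j = j'.
Proof.
have sub (c : seq (seq nat)) i : l \in nth [::] c i -> l \in flatten c.
  elim: c i => [|s c IH] [|i] //=; rewrite mem_cat; first by move=> ->.
  by move=> /IH ->; rewrite orbT.
elim: b ub j j' => [|s c IH] /=; first by move=> _ j j'; rewrite nth_nil.
rewrite cat_uniq => /and3P[_ /hasPn sc uc] [|j] [|j'] //=.
- by move=> ls /sub /sc; rewrite /= ls.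
- by move=> /sub /sc /= /negbTE -> .
- by move=> lj lj'; congr _.+1; exact: IH lj lj'.
Qed.

Lemma round_ofE l j : l \in nth [::] b j -> round_of l = j.
Proof.
move=> lj; have jb : (j < size b)%N.
  by rewrite ltnNge; apply/negP => bj; rewrite nth_default in lj.
have hb : has (fun s => l \in s) b.
  by apply/hasP; exists (nth [::] b j) => //; exact: mem_nth.
exact: (nth_flatten_inj (nth_find [::] hb) lj).
Qed.

Lemma round_of_lt l : (round_of l < size b)%N -> l \in nth [::] b (round_of l).
Proof. by rewrite -has_find => hb; exact: (nth_find [::] hb). Qed.

Lemma round_of_notin l : l \notin flatten b -> round_of l = size b.
Proof.
move=> lb; apply/eqP; rewrite eqn_leq find_size/= leqNgt -has_find.
by apply/hasPn => s sb; apply: contra lb => ls; apply/flattenP; exists s.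
Qed.

(* The values of the draw [Z l m] for which the first rounds can be those of b. *)
Definition draws (l m : nat) : set bool :=
  if (m < round_of l)%N then [set false]
  else if m == round_of l then [set true] else setT.

Context (d : measure_display) (Omega : measurableType d) (R : realType).
Context (P : probability Omega R) (Z : nat -> nat -> {RV P >-> bool}).

Lemma draws_first_rounds w :
  (forall l m, (m < size b)%N -> draws l m (Z l m w)) -> first_rounds_are Z b w.
Proof.
move=> H j l jb; rewrite /appears_at; split.
  move=> /round_ofE lj; split.
    by have := H l j jb; rewrite /draws lj ltnn eqxx/= => ->.
  move=> m mj; have := H l m (ltn_trans mj jb).
  by rewrite /draws lj mj/= => ->.
move=> [Zj Zm]; have := H l j jb; rewrite /draws.
case: ltngtP => [_|jr _|jr _].
- by rewrite /= Zj.
- have rb := ltn_trans jr jb.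
  have := H l _ rb; rewrite /draws ltnn eqxx/= => Zr.
  by have := Zm _ jr; rewrite Zr.
by rewrite jr; apply: round_of_lt; rewrite -jr.
Qed.

(** Draws after the first appearance are unconstrained and contribute 1. *)
Lemma bernoulli_draws (p : R) l : 0 <= p <= 1 ->
  (\prod_(0 <= m < size b) bernoulli_prob p (draws l m) =
   ((1 - p) ^+ round_of l * (if (round_of l < size b)%N then p else 1))%:E)%E.
Proof.
move=> p01.
have bF : (bernoulli_prob p [set false] = (1 - p)%:E)%E.
  by rewrite /bernoulli_prob p01 fsbig_set1.
have bT : (bernoulli_prob p [set true] = p%:E)%E.
  by rewrite /bernoulli_prob p01 fsbig_set1.
(* For the induction, [K] rounds may end before the appearance; hence the minimum in the
   exponent. *)
have H K : (\prod_(0 <= m < K) bernoulli_prob p (draws l m) =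
   ((1 - p) ^+ (minn K (round_of l)) * (if (round_of l < K)%N then p else 1))%:E)%E.
  elim: K => [|K IH]; first by rewrite big_geq// min0n expr0 mulr1.
  rewrite big_nat_recr//= IH /draws.
  case: (ltngtP (round_of l) K) => [rK|Kr|<-].
  - rewrite (probability_setT (bernoulli_prob p)) mule1 (minn_idPr (leqW (ltnW rK))).
    by rewrite ltnS (ltnW rK).
  - rewrite bF -EFinM (minn_idPl Kr) exprS ltnS leqNgt Kr/=.
    by rewrite !mulr1 mulrC.
  - by rewrite bT -EFinM (minn_idPr (leqnSn _)) ltnSn mulr1.
by rewrite H (minn_idPr (find_size _ _)).
Qed.

End Rounds.

Section FirstRoundsBound.
Context (R : realType) (d : measure_display) (Omega : measurableType d).
Context (P : probability Omega R).
Local Notation E := (measurableTypeR R * measurableTypeR R)%type.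
Context (jump : nat -> {RV P >-> E}) (Z : nat -> nat -> {RV P >-> bool}).
Hypothesis size01 : {ae P, forall w, forall l, 0 < (jump l w).1 < 1}.
Hypothesis featZ : feature_allocation jump Z.

Lemma inclusion_probabilityE l w :
  inclusion_probability jump l w = (jump l w).1 * unit_loc (jump l w).
Proof.
rewrite /inclusion_probability /unit_loc indicE; case: ifPn => h.
  by rewrite mem_set// mulr1.
by rewrite memNset ?mulr0//; exact/negP.
Qed.

Lemma measurable_inclusion_probability l :
  measurable_fun setT (inclusion_probability jump l).
Proof.
rewrite (_ : inclusion_probability jump l =
    (fun z : E => z.1 * unit_loc z) \o jump l); last first.
  by apply/funext => w; rewrite inclusion_probabilityE.
apply: measurableT_comp => //; apply: measurable_funM; last exact: measurable_unit_loc.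
exact: measurable_fst.
Qed.

Lemma inclusion_probability01 l w : 0 < (jump l w).1 < 1 ->
  0 <= inclusion_probability jump l w <= 1.
Proof.
move=> /andP[h0 h1]; rewrite inclusion_probabilityE.
by have /orP[/eqP->|/eqP->] := unit_loc01 (jump l w);
  rewrite ?mulr0 ?mulr1 ?lexx ?ler01 ?(ltW h0) ?(ltW h1).
Qed.

Lemma skip_weight_inclusion N l w : 0 < (jump l w).1 < 1 ->
  skip_weight N (jump l w) = (1 - inclusion_probability jump l w) ^+ N.
Proof.
move=> h01; rewrite inclusion_probabilityE /skip_weight indicE mem_set ?mul1r//=.
have /orP[/eqP->|/eqP->] := unit_loc01 (jump l w).
  by rewrite !mulr0 !subr0 expr1n.
by rewrite !mulr1 subKr.
Qed.

Lemma weight_inclusion j B l w : 0 < (jump l w).1 < 1 ->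
  weight j B (jump l w) = \1_B (jump l w).1 *
    (inclusion_probability jump l w * (1 - inclusion_probability jump l w) ^+ j).
Proof.
move=> h01; rewrite inclusion_probabilityE /weight /appear_weight !indicE in_setI.
rewrite [X in _ && X]mem_set ?andbT/= ?in_itv//.
have /orP[/eqP->|/eqP->] := unit_loc01 (jump l w).
  by rewrite !(mulr0, mul0r).
by rewrite !mulr1.
Qed.

Variables (b : seq (seq nat)) (B : nat -> set (measurableTypeR R)).
Hypothesis ub : uniq (flatten b).
Hypothesis mB : forall i, measurable (B i).
Local Notation s := (flatten b).

Definition sizes_in : set Omega :=
  [set w | forall i, (i < size s)%N -> B i (jump (nth 0%N s i) w).1].

Lemma sigma_gen_sizes_in : sigma_gen jump sizes_in.
Proof.
pose G := \bigcup_i preimage_set_system setT (jump i) measurable.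
have -> : sizes_in = \bigcap_(i in [set i | (i < size s)%N])
    (jump (nth 0%N s i) @^-1` (B i `*` setT)).
  by apply/seteqP; split => w /= H i => [/H|iS]; [|case: (H i iS)].
suff : @measurable _ (g_sigma_algebraType G) (\bigcap_(i in [set i | (i < size s)%N])
    (jump (nth 0%N s i) @^-1` (B i `*` setT))) by [].
apply: bigcap_measurableType => i _; apply: sub_sigma_algebra.
exists (nth 0%N s i) => //; exists (B i `*` setT); first exact: measurableX.
by rewrite setTI.
Qed.

Lemma measurable_sizes_in : measurable sizes_in.
Proof.
have -> : sizes_in = \bigcap_(i in [set i | (i < size s)%N])
    (jump (nth 0%N s i) @^-1` (B i `*` setT)).
  by apply/seteqP; split => w /= H i => [/H|iS]; [|case: (H i iS)].
apply: bigcap_measurableType => i _.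
by rewrite -[X in measurable X]setTI; apply: measurable_funPT => //; exact: measurableX.
Qed.

(** Given the jumps, the probability that the draws of label [l] are as [b] prescribes. *)
Let q l w : R := (1 - inclusion_probability jump l w) ^+ round_of b l *
  (if (round_of b l < size b)%N then inclusion_probability jump l w else 1).

(** Only the labels below [L] are constrained, because conditional independence speaks of finite
    families; [L] tends to infinity in [rounds_density_first_rounds]. *)
Let allowed L : set Omega :=
  \bigcap_(lm in [set` [seq (l, m) | l <- iota 0 L, m <- iota 0 (size b)]])
    (Z lm.1 lm.2 @^-1` draws b lm.1 lm.2).

(* A lower bound for the conditional probability, given the jumps, that the
   first rounds are those of b and that the i-th size lies in B i. *)
Definition rounds_density (w : Omega) : R :=
  (\prod_(i <- iota 0 (size s))
    weight (round_of b (nth 0%N s i)) (B i) (jump (nth 0%N s i) w)) *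
  prodx s (skip_weight (size b) \o jump ^~ w).

Lemma rounds_density_ge0 w : 0 <= rounds_density w.
Proof.
rewrite mulr_ge0//; first by apply: prodr_ge0 => i _; exact: weight_ge0.
by apply: prodx_ge0 => l; exact: skip_weight01.
Qed.

Lemma measurable_rounds_density : measurable_fun setT rounds_density.
Proof.
apply: measurable_funM.
  apply: measurable_prod => i _.
  exact: (measurableT_comp (measurable_weight _ (mB i))).
apply: (@measurable_prodx _ _ _ _ _ jump) => //; first exact: measurable_skip_weight.
exact: skip_weight01.
Qed.

(** Labels in [s] match their weights factor by factor. For the other labels the infinite product is
    at most its partial product up to [L], which makes the bound uniform in [L]. *)
Let rounds_density_le w L : (forall l, 0 < (jump l w).1 < 1) ->
  {in s, forall l, (l < L)%N} ->
  rounds_density w <= (\prod_(0 <= l < L) q l w) * \1_sizes_in w.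
Proof.
move=> w01 sL.
have p01 l := inclusion_probability01 (w01 l).
have q0 l : 0 <= q l w.
  have /andP[p0 p1] := p01 l.
  by rewrite mulr_ge0 ?exprn_ge0 ?subr_ge0//; case: ifP.
rewrite indicE; have [wA|wA] := boolP (w \in sizes_in); last first.
  rewrite mulr0 /rounds_density; move/negP: wA; rewrite inE => /existsNP[i /not_implyP[iS Bi]].
  rewrite (bigD1_seq i)/= ?iota_uniq ?mem_iota//.
  by rewrite weight_inclusion// indicE memNset// !mul0r.
rewrite mulr1 (bigID (fun l => l \in s))/=; apply: ler_pM.
- by apply: prodr_ge0 => i _; exact: weight_ge0.
- by apply: prodx_ge0 => l; exact: skip_weight01.
- rewrite -[leRHS]big_filter.
  have ps : perm_eq [seq l <- index_iota 0 L | l \in s] s.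
    apply: uniq_perm; rewrite ?filter_uniq ?iota_uniq// => l.
    rewrite mem_filter mem_index_iota/=.
    by case: (boolP (l \in s)) => //= /sL.
  rewrite (perm_big _ ps)/= [leRHS](big_nth 0%N) big_seq [leRHS]big_seq /index_iota subn0.
  apply: ler_prod => i; rewrite mem_iota/= add0n => iS.
  rewrite weight_ge0/= weight_inclusion// /q.
  have -> : (round_of b (nth 0%N s i) < size b)%N.
    rewrite -has_find; have : nth 0%N s i \in s by exact: mem_nth.
    by move=> /flattenP[c cb ic]; apply/hasP; exists c.
  rewrite mulrC [X in _ <= X]mulrC ler_piMr ?indicE ?lern1 ?leq_b1//.
  by rewrite mulr_ge0 ?exprn_ge0 ?subr_ge0//; case/andP: (p01 (nth 0%N s i)).
- apply: (@le_trans _ _ (prodn s (skip_weight (size b) \o jump ^~ w) L)).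
    by apply: prodx_le => l; exact: skip_weight01.
  rewrite /prodn le_eqVlt; apply/orP; left; apply/eqP.
  apply: eq_bigr => l ls; rewrite /= skip_weight_inclusion// /q.
  by rewrite round_of_notin// ltnn mulr1.
Qed.

Lemma measurable_appears_at l j : measurable [set w | appears_at Z w l j].
Proof.
have mZ (i : nat) (A : set bool) : measurable (Z l i @^-1` A).
  by rewrite -[X in measurable X]setTI; exact: measurable_funPT.
have -> : [set w | appears_at Z w l j] = (Z l j @^-1` [set true]) `&`
    \bigcap_(m in [set m | (m < j)%N]) (Z l m @^-1` [set false]).
  apply/seteqP; split => w /=.
    by move=> [-> Zm]; split => // m /= /Zm /negbTE.
  by move=> [Zj Zm]; split => // m /Zm /= ->.
by apply: measurableI => //; exact: bigcap_measurableType.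
Qed.

Lemma measurable_first_rounds : measurable (first_rounds_are Z b).
Proof.
have -> : first_rounds_are Z b = \bigcap_(j in [set j | (j < size b)%N]) \bigcap_l
    [set w | l \in nth [::] b j <-> appears_at Z w l j].
  by apply/seteqP; split => w H j /= => [jb l _|l jb]; exact: H.
apply: bigcap_measurableType => j _; apply: bigcap_measurableType => l _.
have [lb|lb] := boolP (l \in nth [::] b j).
  rewrite (_ : [set _ | _] = [set w | appears_at Z w l j]).
    exact: measurable_appears_at.
  by apply/seteqP; split => w /= => [[+ _]|//]; exact.
rewrite (_ : [set _ | _] = ~` [set w | appears_at Z w l j]).
  by apply: measurableC; exact: measurable_appears_at.
by apply/seteqP; split => w /= => [[_ H] /H//|H]; split => // /H.
Qed.

Let measurable_allowed L : measurable (allowed L).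
Proof.
apply: fin_bigcap_measurable => [|lm _]; first exact: finite_seq.
by rewrite -[X in measurable X]setTI; exact: measurable_funPT.
Qed.

Let allowed_le L : {in s, forall l, (l < L)%N} ->
  (\int[P]_w (rounds_density w)%:E <= P (sizes_in `&` allowed L))%E.
Proof.
move=> sL; rewrite featZ//; last 2 first.
- exact: sigma_gen_sizes_in.
- by apply: allpairs_uniq; rewrite ?iota_uniq// => -[? ?] [? ?] _ _ [-> ->].
under [leRHS]eq_integral do rewrite big_allpairs/=.
rewrite -[in leRHS](setTI sizes_in) -integral_mul_indic.
have mbern l m : measurable_fun setT
    (fun w => bernoulli_prob (inclusion_probability jump l w) (draws b l m)).
  apply: (measurableT_comp (@measurable_bernoulli_prob2 R (draws b l m) _)) => //.
  exact: measurable_inclusion_probability.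
have mprode (J : seq nat) (F : nat -> Omega -> \bar R) :
    (forall i, measurable_fun setT (F i)) ->
    measurable_fun setT (fun w => \prod_(i <- J) F i w)%E.
  move=> mF; elim: J => [|i J IH].
    by under eq_fun do rewrite big_nil; exact: measurable_cst.
  by under eq_fun do rewrite big_cons; exact: emeasurable_funM.
apply: ae_ge0_le_integral => //.
- by move=> w _; rewrite lee_fin rounds_density_ge0.
- by apply/measurable_EFinP; exact: measurable_rounds_density.
- move=> w _; apply: mule_ge0; last by rewrite lee_fin.
  by apply: prode_ge0 => l _; apply: prode_ge0 => m _; exact: measure_ge0.
- apply: emeasurable_funM; last first.
    by apply/measurable_EFinP; apply: measurable_indic; exact: measurable_sizes_in.
  by apply: (mprode _ _) => l; exact: (mprode _ _).
apply: filterS size01 => w w01 _.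
have -> : (\prod_(l <- iota 0 L) \prod_(m <- iota 0 (size b))
    bernoulli_prob (inclusion_probability jump l w) (draws b l m) =
    (\prod_(0 <= l < L) q l w)%:E)%E.
  rewrite -prodEFin /index_iota subn0; apply: eq_bigr => l _.
  have := @bernoulli_draws b R _ l (inclusion_probability01 (w01 l)).
  by rewrite /index_iota subn0.
by rewrite -EFinM lee_fin; exact: rounds_density_le.
Qed.

(** The events [sizes_in] with [allowed L] decrease in [L], and their intersection forces the first
    rounds to be [b]. The bound of [allowed_le] holds as soon as [L] exceeds all labels of [b], so
    it survives the limit. *)
Lemma rounds_density_first_rounds :
  (\int[P]_w (rounds_density w)%:E <= P (sizes_in `&` first_rounds_are Z b))%E.
Proof.
have [K sK] : exists K, {in s, forall l, (l < K)%N}.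
  exists (\max_(l <- s) l).+1 => l ls.
  by rewrite ltnS; apply: (@leq_bigmax_seq _ s xpredT (fun i => i) l).
have mcap : measurable (\bigcap_L (sizes_in `&` allowed L)).
  apply: bigcap_measurableType => L _; apply: measurableI.
    exact: measurable_sizes_in.
  exact: measurable_allowed.
have cvgP : (P (sizes_in `&` allowed L) @[L --> \oo] -->
    P (\bigcap_L (sizes_in `&` allowed L)))%E.
  apply: nonincreasing_cvg_mu => //.
  - apply: le_lt_trans (probability_le1 _ _) _; last by rewrite ltry.
    by apply: measurableI; [exact: measurable_sizes_in|exact: measurable_allowed].
  - by move=> L; apply: measurableI; [exact: measurable_sizes_in|exact: measurable_allowed].
  - move=> L L' LL'; rewrite subsetEset; apply: setIS => w H [l m]/= lm.
    apply: (H (l, m)) => /=; move: lm.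
    move=> /allpairsP[[l1 m1]/= [l1L m1b [-> ->]]].
    apply/allpairsP; exists (l1, m1); split => //=; move: l1L.
    by rewrite !mem_iota/= !add0n => /leq_trans; exact.
apply: (@le_trans _ _ (P (\bigcap_L (sizes_in `&` allowed L)))).
  rewrite -(cvg_lim _ cvgP)//; apply: lime_ge; first by apply/cvg_ex; eexists; exact: cvgP.
  apply: filterS (nbhs_infty_ge K) => L KL; apply: allowed_le => l ls.
  exact: leq_trans (sK l ls) KL.
apply: le_measure; rewrite ?inE//.
  by apply: measurableI; [exact: measurable_sizes_in|exact: measurable_first_rounds].
move=> w H; split; first by case: (H 0%N I).
apply: draws_first_rounds => // l m mb.
have lm : (l, m) \in [seq (l, m) | l <- iota 0 l.+1, m <- iota 0 (size b)].
  by apply/allpairsP; exists (l, m); rewrite !mem_iota /= !add0n ltnS leqnn mb.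
by have [_ /(_ (l, m) lm)] := H l.+1 I.
Qed.

End FirstRoundsBound.

Lemma uniq_flatten_all (T : eqType) (b : seq (seq T)) : uniq (flatten b) -> all uniq b.
Proof. by elim: b => //= s b IH; rewrite cat_uniq => /and3P[-> _ /IH]. Qed.

(** * Jump sizes in order of appearance *)

Section Appearance.
Context (R : realType) (d : measure_display) (Omega : measurableType d).
Context (P : probability Omega R).
Local Notation E := (measurableTypeR R * measurableTypeR R)%type.
Context (jump : nat -> {RV P >-> E}) (Z : nat -> nat -> {RV P >-> bool}).
Context (sigma : nat -> {RV P >-> nat}).
Hypothesis size01 : {ae P, forall w, forall l, 0 < (jump l w).1 < 1}.
Hypothesis featZ : feature_allocation jump Z.
Hypothesis ooa : order_of_appearance jump Z sigma.
Variables (k : seq nat) (B : nat -> set (measurableTypeR R)).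
Hypothesis mB : forall i, measurable (B i).
Local Notation n := (sumn k).

Definition rounds_shaped : set Omega :=
  [set w | exists b, [/\ shape b = k, uniq (flatten b) & first_rounds_are Z b w]].

Definition sorted_sizes_in : set Omega :=
  [set w | forall i, (i < n)%N -> B i (jump (sigma i w) w).1].

Definition starts_with (t : seq nat) : set Omega :=
  [set w | forall i, (i < size t)%N -> sigma i w = nth 0%N t i].

Lemma measurable_rounds_shaped : measurable rounds_shaped.
Proof.
have -> : rounds_shaped = \bigcup_(b in @setT (seq (seq nat)))
    (if (shape b == k) && uniq (flatten b) then first_rounds_are Z b else set0).
  apply/seteqP; split => w /=.
    by move=> [b [bk ub fb]]; exists b => //; rewrite bk eqxx ub.
  by move=> [b _]; case: ifP => // /andP[/eqP bk ub fb]; exists b.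
apply: countable_bigcupT_measurable => [|b]; first exact: countableP.
case: ifP => // _.
exact: measurable_first_rounds.
Qed.

Lemma measurable_sorted_size (A : set (measurableTypeR R)) i : measurable A ->
  measurable [set w | A (jump (sigma i w) w).1].
Proof.
move=> mA; have -> : [set w | A (jump (sigma i w) w).1] =
    \bigcup_l (sigma i @^-1` [set l] `&` jump l @^-1` (A `*` setT)).
  apply/seteqP; split => w /=.
    by move=> Aw; exists (sigma i w).
  by move=> [l _ [/= -> []]].
apply: bigcupT_measurable => l; apply: measurableI.
  by rewrite -[X in measurable X]setTI; exact: measurable_funPT.
by rewrite -[X in measurable X]setTI; apply: measurable_funPT => //; exact: measurableX.
Qed.

Lemma measurable_sorted_sizes_in : measurable sorted_sizes_in.
Proof.
have -> : sorted_sizes_in = \bigcap_(i in [set i | (i < n)%N])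
    [set w | B i (jump (sigma i w) w).1].
  by apply/seteqP; split => w H i /= => /H.
by apply: bigcap_measurableType => i _; exact: measurable_sorted_size.
Qed.

Lemma measurable_starts_with t : measurable (starts_with t).
Proof.
have -> : starts_with t = \bigcap_(i in [set i | (i < size t)%N])
    (sigma i @^-1` [set nth 0%N t i]).
  by apply/seteqP; split => w H i /= => /H.
apply: bigcap_measurableType => i _.
by rewrite -[X in measurable X]setTI; exact: measurable_funPT.
Qed.

Let w_ i := weight (reshape_index k i) (B i).
(** The conditional probability of one prescribed order inside rounds of sizes [k]. *)
Let c : R := \prod_(m <- k) (m`!%:R)^-1.
Let reached t := rounds_shaped `&` sorted_sizes_in `&` starts_with t.

Let mreached t : measurable (reached t).
Proof.
apply: measurableI; last exact: measurable_starts_with.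
by apply: measurableI; [exact: measurable_rounds_shaped|exact: measurable_sorted_sizes_in].
Qed.

(** Cutting [t] into consecutive blocks of lengths [k] recovers the rounds [b]; then [ooa_uniform]
    supplies the factor [c]. *)
Let reached_full t : uniq t -> size t = n ->
  (c%:E * \int[P]_x ((\prod_(i <- iota 0 n) w_ i (jump (nth 0%N t i) x)) *
      prodx t (skip_weight (size k) \o jump ^~ x))%:E <= P (reached t))%E.
Proof.
move=> ut tn; pose b := reshape k t.
have bt : flatten b = t by rewrite reshapeKr ?tn.
have bk : shape b = k by rewrite reshapeKl ?tn.
have ub : uniq (flatten b) by rewrite bt.
have sb : size b = size k by rewrite size_reshape.
have roundE i : (i < n)%N -> round_of b (nth 0%N t i) = reshape_index k i.
  move=> iN; apply: round_ofE => //; rewrite -bt nth_flatten bk; apply: mem_nth.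
  have := reshape_offsetP iN; rewrite -{2}bk /shape (nth_map [::])//.
  by rewrite sb reshape_indexP.
have cE : \prod_(s <- b) ((size s)`!%:R : R)^-1 = c.
  by rewrite /c -{1}bk /shape big_map.
have <- : (\int[P]_w (rounds_density jump b B w)%:E)%E =
  (\int[P]_x ((\prod_(i <- iota 0 n) w_ i (jump (nth 0%N t i) x)) *
      prodx t (skip_weight (size k) \o jump ^~ x))%:E)%E.
  apply: eq_integral => w _; rewrite /rounds_density bt sb tn; congr (_ * _)%:E.
  rewrite big_seq [RHS]big_seq; apply: eq_bigr => i; rewrite mem_iota/= add0n => iN.
  by rewrite roundE.
have c0 : (0 <= c%:E)%E by rewrite lee_fin; apply: prodr_ge0 => i _; rewrite invr_ge0.
apply: (le_trans (lee_wpmul2l c0 (rounds_density_first_rounds size01 featZ ub mB))).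
have := @ooa_uniform _ _ _ _ _ _ _ ooa (sizes_in jump b B) b.
rewrite cE => <-; last 2 first.
- by apply: sub_sigma_algebra; left; exact: sigma_gen_sizes_in.
- exact: uniq_flatten_all.
have -> : [set w | forall i, (i < size (flatten b))%N -> sigma i w = nth 0%N (flatten b) i]
    = starts_with t by rewrite bt.
apply: le_measure; rewrite ?inE//.
  apply: measurableI; last exact: measurable_starts_with.
  by apply: measurableI; [exact: measurable_sizes_in|exact: measurable_first_rounds].
move=> w [[Aw fw] sw]; split => //.
  split; first by exists b.
  move=> i iN; have iS : (i < size (flatten b))%N by rewrite bt tn.
  rewrite sw ?tn// -bt; exact: Aw.
Qed.

(** The induction follows the recursion of [distinct_sum]. Appending different labels to [t] gives
    disjoint events, since [sigma] takes a single value at position [size t]; a label already in [t]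
    contributes 0 to the left side. *)
Let reached_ge m t : uniq t -> (size t + m)%N = n ->
  (c%:E * \int[P]_x ((\prod_(i <- iota 0 (size t)) w_ i (jump (nth 0%N t i) x))%:E *
      distinct_sum [seq w_ i | i <- iota (size t) m]
        (skip_weight (size k)) t (jump ^~ x)) <= P (reached t))%E.
Proof.
elim: m t => [|m IH] t ut.
  rewrite addn0 => tn; rewrite tn; apply: le_trans (reached_full ut tn).
  by under eq_integral do rewrite -EFinM.
move=> tn; have c0 : (0 <= c%:E)%E.
  by rewrite lee_fin; apply: prodr_ge0 => i _; rewrite invr_ge0.
have trt : trivIset setT (fun l => reached (rcons t l)).
  move=> l l' _ _ [w [[_ wl] [_ wl']]].
  have := wl (size t); have := wl' (size t); rewrite !size_rcons ltnSn !nth_rcons ltnn eqxx.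
  by move=> /(_ isT) <- /(_ isT).
apply: (@le_trans _ _ (P (\bigcup_l reached (rcons t l)))); last first.
  apply: le_measure; rewrite ?inE//; first exact: bigcupT_measurable.
  move=> w [l _ [H wl]]; split => // i it.
  by rewrite wl ?size_rcons ?leqW// nth_rcons it.
rewrite measure_bigcup//.
pose pr x := \prod_(i <- iota 0 (size t)) w_ i (jump (nth 0%N t i) x).
have pr0 x : 0 <= pr x by apply: prodr_ge0 => i _; exact: weight_ge0.
have mpr : measurable_fun setT pr.
  by apply: measurable_prod => i _; exact: (measurableT_comp (measurable_weight _ (mB i))).
pose fs := [seq w_ i | i <- iota (size t).+1 m].
have mfs : {in fs, forall f, measurable_fun setT f}.
  by move=> f /mapP[i _ ->]; exact: measurable_weight.
have fs0 : {in fs, forall f z, 0 <= f z}.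
  by move=> f /mapP[i _ ->] z; exact: weight_ge0.
have ds0 s x : (0 <= distinct_sum fs (skip_weight (size k)) s (jump ^~ x))%E.
  by apply: distinct_sum_ge0 => //; exact: skip_weight01.
have mds s : measurable_fun setT
    (fun x => distinct_sum fs (skip_weight (size k)) s (jump ^~ x)).
  apply: (measurable_distinct_sum (X := fun l => jump l)) => //.
    exact: measurable_skip_weight.
  exact: skip_weight01.
pose T l x := ((pr x * ((l \notin t)%:R * w_ (size t) (jump l x)))%:E *
  distinct_sum fs (skip_weight (size k)) (rcons t l) (jump ^~ x))%E.
have T0 l x : (0 <= T l x)%E.
  apply: mule_ge0 => //; rewrite lee_fin; apply: mulr_ge0 => //.
  by apply: mulr_ge0 => //; exact: weight_ge0.
have mT l : measurable_fun setT (T l).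
  apply: emeasurable_funM => //; apply/measurable_EFinP.
  apply: measurable_funM => //; apply: measurable_funM => //.
  exact: (measurableT_comp (measurable_weight _ (mB (size t)))).
have -> : (\int[P]_x ((pr x)%:E * distinct_sum (w_ (size t) :: fs)
    (skip_weight (size k)) t (jump ^~ x)) = \sum_(0 <= l <oo) \int[P]_x T l x)%E.
  rewrite -integral_nneseries//; apply: eq_integral => x _ /=.
  rewrite -nneseriesZl//; last first.
    by move=> l _; apply: mule_ge0 => //; rewrite lee_fin; apply: mulr_ge0 => //; exact: weight_ge0.
  by apply: eq_eseriesr => l _; rewrite muleA -EFinM.
rewrite -nneseriesZl//; last by move=> l _; exact: integral_ge0.
rewrite [leRHS](_ : _ = \sum_(0 <= l <oo) P (reached (rcons t l)))%E; last first.
  by apply: eq_eseriesl => l; rewrite in_setT.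
apply: lee_nneseries => [l _|l _]; first by rewrite mule_ge0// integral_ge0.
have [lt|lt] := boolP (l \in t).
  rewrite (_ : (\int[P]_x T l x = 0)%E) ?mule0//.
  under eq_integral do rewrite /T lt mul0r mulr0 mul0e.
  exact: integral0.
have := IH (rcons t l); rewrite rcons_uniq lt ut size_rcons addSnnS => /(_ isT tn).
apply: le_trans; rewrite lee_wpmul2l//.
rewrite le_eqVlt; apply/orP; left; apply/eqP; apply: eq_integral => x _.
rewrite /T lt mul1r; congr (_%:E * _)%E.
rewrite -addn1 iotaD big_cat/= big_cons big_nil mulr1 nth_rcons ltnn eqxx.
congr (_ * _); rewrite /pr big_seq [RHS]big_seq; apply: eq_bigr => i.
by rewrite mem_iota/= add0n nth_rcons => ->.
Qed.

Lemma rounds_shaped_ge :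
  (c%:E * \int[P]_x distinct_sum [seq w_ i | i <- iota 0 n]
        (skip_weight (size k)) [::] (jump ^~ x) <=
   P (rounds_shaped `&` sorted_sizes_in))%E.
Proof.
have := @reached_ge n [::] isT (add0n _); rewrite /=.
under eq_integral do rewrite big_nil mul1e.
move=> /le_trans; apply; apply: le_measure; rewrite ?inE//.
  by apply: measurableI; [exact: measurable_rounds_shaped|exact: measurable_sorted_sizes_in].
by move=> w [].
Qed.

End Appearance.

Lemma reshape_index_cons m k i :
  reshape_index (m :: k) i = if (i < m)%N then 0%N else (reshape_index k (i - m)).+1.
Proof.
rewrite /reshape_index/= subn_eq0; case: ltnP => // mi.
by rewrite subSn.
Qed.

(** Round j owns [nth 0 k j] consecutive positions. *)
Lemma prod_reshape_index (R : comNzRingType) (F : nat -> R) (k : seq nat) :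
  \prod_(i <- iota 0 (sumn k)) F (reshape_index k i) =
  \prod_(0 <= j < size k) F j ^+ nth 0%N k j.
Proof.
elim: k F => [|m k IH] F /=; first by rewrite big_nil big_geq.
rewrite iotaD big_cat/= big_nat_recl//=; congr (_ * _).
  rewrite big_seq (eq_bigr (fun=> F 0%N)); last first.
    by move=> i; rewrite mem_iota/= add0n reshape_index_cons => ->.
  by rewrite -big_seq big_const_seq count_predT size_iota iter_mulr_1.
rewrite add0n -[m in iota m]addn0 iotaDl big_map -IH; apply: eq_bigr => i _.
by rewrite reshape_index_cons ltnNge leq_addr/= addKn.
Qed.

(** * The Indian buffet process *)

Section IBPSide.
Context (R : realType) (gamma theta : R).
Hypotheses (gamma_gt0 : 0 < gamma) (theta_gt0 : 0 < theta).
Context (d : measure_display) (Omega : measurableType d) (P : probability Omega R).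
Context (Kplus : nat -> {RV P >-> nat}) (V : nat -> {RV P >-> R}).
Hypothesis ibp : ibp_stick_lengths gamma theta Kplus V.
Local Notation rate := (stick_rate gamma theta).

Definition counts_are (k : seq nat) : set Omega :=
  [set w | forall j, (j < size k)%N -> Kplus j w = nth 0%N k j].

Definition sticks_in (k : seq nat) (B : nat -> set (measurableTypeR R)) : set Omega :=
  [set w | forall i, (i < sumn k)%N -> B i (V i w)].

(** Arranged as the jump side delivers it: the factorials come from the uniform orders, one factor
    per point and the exponential from the Mecke formula. For the sticks, the same factors regroup
    into Poisson masses and Beta probabilities. *)
Definition stick_prob (k : seq nat) (B : nat -> set (measurableTypeR R)) : R :=
  (\prod_(m <- k) (m`!%:R)^-1) *
  ((\prod_(i <- iota 0 (sumn k)) (rate (reshape_index k i) *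
      fine (beta_law 1 (theta + (reshape_index k i)%:R) (B i)))) *
   expR (- \sum_(0 <= j < size k) rate j)).

Lemma counts_areE k : counts_are k =
  \bigcap_(j in [set` iota 0 (size k)]) Kplus j @^-1` [set nth 0%N k j].
Proof.
apply/seteqP; split => w H j.
  by rewrite /= mem_iota/= add0n => /H.
by move=> jk; apply: H; rewrite /= mem_iota.
Qed.

Lemma measurable_counts_are k : measurable (counts_are k).
Proof.
rewrite counts_areE; apply: fin_bigcap_measurable => [|j _]; first exact: finite_seq.
by rewrite -[X in measurable X]setTI; exact: measurable_funPT.
Qed.

Lemma sticks_inE k B : sticks_in k B =
  \bigcap_(i in [set` iota 0 (sumn k)]) V i @^-1` B i.
Proof.
apply/seteqP; split => w H j.
  by rewrite /= mem_iota/= add0n => /H.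
by move=> jk; apply: H; rewrite /= mem_iota.
Qed.

Lemma measurable_sticks_in k B : (forall i, measurable (B i)) -> measurable (sticks_in k B).
Proof.
move=> mB; rewrite sticks_inE; apply: fin_bigcap_measurable => [|j _]; first exact: finite_seq.
by rewrite -[X in measurable X]setTI; apply: measurable_funPT => //; exact: mB.
Qed.

Lemma sigma_gen_counts_are k : sigma_gen Kplus (counts_are k).
Proof.
pose G := \bigcup_i preimage_set_system setT (Kplus i) measurable.
suff : @measurable _ (g_sigma_algebraType G) (counts_are k) by [].
rewrite counts_areE; apply: fin_bigcap_measurable => [|j _]; first exact: finite_seq.
apply: sub_sigma_algebra; exists j => //; exists [set nth 0%N k j] => //.
by rewrite setTI.
Qed.

Lemma prob_Kplus j m : P (Kplus j @^-1` [set m]) =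
  (rate j ^+ m / m`!%:R * expR (- rate j))%:E.
Proof.
have := ibp_counts ibp j [set m]; rewrite /distribution/= /pushforward => ->.
have r0 := stick_rate_gt0 gamma_gt0 theta_gt0 j.
rewrite /poisson_prob -/(stick_rate gamma theta j) r0 esum_set1.
  by rewrite /poisson_pmf r0.
by rewrite lee_fin poisson_pmf_ge0.
Qed.

Lemma prob_counts_are k : P (counts_are k) =
  (\prod_(0 <= j < size k)
    (rate j ^+ nth 0%N k j / (nth 0%N k j)`!%:R * expR (- rate j)))%:E.
Proof.
rewrite counts_areE (ibp_counts_independent ibp)//; last exact: iota_uniq.
rewrite -prodEFin /index_iota subn0; apply: eq_bigr => j _.
exact: prob_Kplus.
Qed.

(** The partial sums are nondecreasing, so position i lies in exactly one round and [xget] has a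
    unique candidate. *)
Lemma ibp_round_counts k w i : counts_are k w -> (i < sumn k)%N ->
  ibp_round Kplus i w = reshape_index k i.
Proof.
move=> kw ik; have rk := reshape_indexP ik.
have sumE j : (j <= size k)%N -> (\sum_(m < j) Kplus m w)%N = sumn (take j k).
  elim: j => [|j IH] jk; first by rewrite big_ord0 take0.
  rewrite big_ord_recr/= IH ?(ltnW jk)// kw// (take_nth 0%N)//.
  by rewrite sumn_rcons.
have mono a b : (a <= b)%N -> (\sum_(m < a) Kplus m w <= \sum_(m < b) Kplus m w)%N.
  move=> ab; rewrite -!(big_mkord xpredT (fun m => Kplus m w)) (@big_cat_nat _ _ _ a 0 b)//=.
  exact: leq_addr.
have : (\sum_(m < reshape_index k i) Kplus m w <= i <
        \sum_(m < (reshape_index k i).+1) Kplus m w)%N.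
  rewrite !sumE ?(ltnW rk)// (take_nth 0%N rk) sumn_rcons.
  have := reshape_indexK k i; have := reshape_offsetP ik; rewrite /flatten_index.
  by move=> h1 h2; rewrite -{2 3}h2 leq_addr ltn_add2l.
move=> /andP[r1 r2]; apply: xget_unique; first by rewrite /= r1.
move=> y /= /andP[y1 y2]; apply/eqP; rewrite eqn_leq; apply/andP; split.
  rewrite leqNgt; apply/negP => /mono h.
  by have := leq_trans r2 (leq_trans h y1); rewrite ltnn.
rewrite leqNgt; apply/negP => /mono h.
by have := leq_trans y2 (leq_trans h r1); rewrite ltnn.
Qed.

Lemma prob_counts_sticks k B : (forall i, measurable (B i)) ->
  P (counts_are k `&` sticks_in k B) = (stick_prob k B)%:E.
Proof.
move=> mB; rewrite sticks_inE (ibp_sticks ibp) ?iota_uniq//; last exact: sigma_gen_counts_are.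
have tj j : 0 < theta + j%:R by rewrite ltr_wpDr.
(* On [counts_are k] the random Beta parameters are constants. *)
transitivity (\int[P]_(w in counts_are k)
    (\prod_(i <- iota 0 (sumn k))
      fine (beta_law 1 (theta + (reshape_index k i)%:R) (B i)))%:E)%E.
  apply: eq_integral => w /set_mem kw; rewrite -prodEFin big_seq [RHS]big_seq.
  apply: eq_bigr => i; rewrite mem_iota/= add0n => ik.
  by rewrite (ibp_round_counts kw ik) fineK// beta_law_fin_num.
rewrite integral_cst//; last exact: measurable_counts_are.
rewrite [X in (_ * X)%E](prob_counts_are k) -EFinM /stick_prob; congr EFin.
have -> : \prod_(0 <= j < size k)
    (rate j ^+ nth 0%N k j / (nth 0%N k j)`!%:R * expR (- rate j)) =
    (\prod_(0 <= j < size k) rate j ^+ nth 0%N k j) *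
    (\prod_(0 <= j < size k) ((nth 0%N k j)`!%:R)^-1) *
    (\prod_(0 <= j < size k) expR (- rate j)) by rewrite -!big_split.
rewrite -(prod_reshape_index rate k) -expR_sum -sumrN [X in _ = _ * (X * _)]big_split/=.
have -> : \prod_(m <- k) (m`!%:R : R)^-1 = \prod_(0 <= j < size k) ((nth 0%N k j)`!%:R)^-1.
  by rewrite (big_nth 0%N).
set x1 := \prod_(i <- _) fine _; set x2 := \prod_(i <- _) rate _.
set x3 := \prod_(_ <= _ < _) _; set x4 := expR _.
by ring.
Qed.

End IBPSide.

(** * Comparison of the two laws for given round sizes *)

Section Comparison.
Context (R : realType) (gamma theta : R).
Hypotheses (gamma_gt0 : 0 < gamma) (theta_gt0 : 0 < theta).
Local Notation E := (measurableTypeR R * measurableTypeR R)%type.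
Local Notation levy := (beta_process_levy gamma_gt0 theta_gt0).
Context (d : measure_display) (Omega : measurableType d) (P : probability Omega R).
Context (jump : nat -> {RV P >-> E}) (Z : nat -> nat -> {RV P >-> bool}).
Context (sigma : nat -> {RV P >-> nat}).
Context (d' : measure_display) (Omega' : measurableType d') (P' : probability Omega' R).
Context (Kplus : nat -> {RV P' >-> nat}) (V : nat -> {RV P' >-> R}).
Hypothesis ppp : poisson_point_process jump (jump_intensity levy).
Hypothesis featZ : feature_allocation jump Z.
Hypothesis ooa : order_of_appearance jump Z sigma.
Hypothesis ibp : ibp_stick_lengths gamma theta Kplus V.

Lemma stick_prob_le_rounds k (B : nat -> set (measurableTypeR R)) (q : R) :
  (forall i, measurable (B i)) -> q < 1 -> (forall i x, B i x -> x <= q) ->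
  ((stick_prob gamma theta k B)%:E <=
    P (rounds_shaped Z k `&` sorted_sizes_in jump sigma k B))%E.
Proof.
move=> mB q1 Bq.
have := rounds_shaped_ge (jump_size01 ppp) featZ ooa k mB.
rewrite (@distinct_sum_beta_process _ _ _ gamma_gt0 theta_gt0 _ _ _ _ ppp _ _ _ _ q)//.
by move=> i; exact: reshape_indexP.
Qed.

(** Removes the bound q < 1: the sides [B i] are cut at q m, which increases to 1, and the
    probabilities of the sticks converge by monotonicity. *)
Lemma counts_sticks_le_rounds k (B : nat -> set (measurableTypeR R)) :
  (forall i, measurable (B i)) ->
  (P' (counts_are Kplus k `&` sticks_in V k B) <=
    P (rounds_shaped Z k `&` sorted_sizes_in jump sigma k B))%E.
Proof.
move=> mB.
pose q m : R := 1 - m.+2%:R^-1.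
have q1 m : q m < 1 by rewrite gtrBl invr_gt0.
have qle m m' : (m <= m')%N -> q m <= q m'.
  by move=> mm'; rewrite lerB// lef_pV2 ?posrE ?ltr0n// ler_nat.
pose Bq m i : set (measurableTypeR R) := B i `&` [set` `]-oo, q m]].
have mBq m i : measurable (Bq m i).
  by apply: measurableI => //; exact: measurable_itv.
pose F m := counts_are Kplus k `&` sticks_in V k (Bq m).
have mF m : measurable (F m).
  by apply: measurableI; [exact: measurable_counts_are|exact: measurable_sticks_in].
have mUF : measurable (\bigcup_m F m) by exact: bigcupT_measurable.
have cvgF : (P' (F m) @[m --> \oo] --> P' (\bigcup_m F m))%E.
  apply: nondecreasing_cvg_mu => // m m' mm'; rewrite subsetEset; apply: setIS.
  move=> w H i ik; have [Bi] := H i ik; rewrite /= in_itv/= => Vq; split => //=.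
  by rewrite in_itv/= (le_trans Vq)// qle.
have FP m : (P' (F m) <= P (rounds_shaped Z k `&` sorted_sizes_in jump sigma k B))%E.
  rewrite (prob_counts_sticks gamma_gt0 theta_gt0 ibp k (mBq m)).
  apply: (le_trans (@stick_prob_le_rounds k (Bq m) (q m) (mBq m) (q1 m) _)).
    by move=> i x [_]; rewrite /= in_itv.
  apply: le_measure; rewrite ?inE//.
  - apply: measurableI; first exact: measurable_rounds_shaped.
    exact: measurable_sorted_sizes_in.
  - apply: measurableI; first exact: measurable_rounds_shaped.
    exact: measurable_sorted_sizes_in.
  - by apply: setIS => w H i /H[].
(* The cut sides exhaust only [B i] below 1; the remainder is not charged, as the Beta laws live on
   []0, 1[]. *)
pose B1 i : set (measurableTypeR R) := B i `&` [set` `]-oo, 1%R[ ].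
have mB1 i : measurable (B1 i) by apply: measurableI => //; exact: measurable_itv.
have UF : \bigcup_m F m = counts_are Kplus k `&` sticks_in V k B1.
  apply/seteqP; split => w.
    move=> [m _ [kw H]]; split => // i /H[Bi]; rewrite /= in_itv/= => Vq; split => //=.
    by rewrite in_itv/= (le_lt_trans Vq).
  move=> [kw H].
  (* Each stick is below some q m; finitely many positions matter, so the largest of these m serves
     all of them. *)
  have /choice[f fP] : forall i, exists m, (i < sumn k)%N -> V i w <= q m.
    move=> i; have [ik|] := boolP (i < sumn k)%N; last by exists 0%N.
    have [_] := H i ik; rewrite /= in_itv/= => V1.
    have V1' : 0 < 1 - V i w by rewrite subr_gt0.
    exists (Num.truncn (1 - V i w)^-1) => _.
    rewrite /q lerBrDr addrC -lerBrDr invf_ple ?posrE ?ltr0n//.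
    apply: (@le_trans _ _ (Num.truncn (1 - V i w)^-1).+1%:R).
      by apply/ltW; rewrite truncnS_gt.
    by rewrite ler_nat.
  exists (\max_(i < sumn k) f i)%N => //; split => // i ik; split.
    by have [] := H i ik.
  rewrite /= in_itv/=; apply: (le_trans (fP i ik)); apply: qle.
  exact: (@leq_bigmax _ (fun i : 'I_(sumn k) => f i) (Ordinal ik)).
have -> : (P' (counts_are Kplus k `&` sticks_in V k B) = P' (\bigcup_m F m))%E.
  rewrite UF !(prob_counts_sticks gamma_gt0 theta_gt0 ibp)// /stick_prob; congr EFin.
  congr (_ * (_ * _)); apply: eq_bigr => i _; congr (_ * fine _).
  rewrite !beta_lawE ?ltr_wpDr//; congr (_ * _)%E; congr (integral _ _ _).
  apply/seteqP; split => [x [Bx x01]|x [[Bx _] x01]]; split => //; split => //.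
  by move: x01; rewrite /= !in_itv/= => /andP[_ ->].
rewrite -(cvg_lim _ cvgF)//; apply: lime_le; first by apply/cvg_ex; eexists; exact: cvgF.
by apply: nearW => m; exact: FP.
Qed.

End Comparison.

(** * Almost surely there are infinitely many sticks *)

Section StickCount.
Context (R : realType) (gamma theta : R).
Hypotheses (gamma_gt0 : 0 < gamma) (theta_gt0 : 0 < theta).
Context (d : measure_display) (Omega : measurableType d) (P : probability Omega R).
Context (Kplus : nat -> {RV P >-> nat}) (V : nat -> {RV P >-> R}).
Hypothesis ibp : ibp_stick_lengths gamma theta Kplus V.
Local Notation rate := (stick_rate gamma theta).

(** Comparison with the harmonic series, from theta + j <= (theta + 1) (j + 1). *)
Lemma stick_rate_unbounded M U : exists L, U < \sum_(j <- iota M L) rate j.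
Proof.
apply: contrapT => /forallNP H.
have C0 : 0 < gamma * theta / (theta + 1).
  by rewrite divr_gt0 ?mulr_gt0// ltr_wpDr.
have rate_ge j : gamma * theta / (theta + 1) * harmonic j <= rate j.
  rewrite /stick_rate /harmonic/= -mulrA ler_pM2l ?mulr_gt0//.
  rewrite -invfM lef_pV2 ?posrE ?mulr_gt0 ?ltr_wpDr//.
  rewrite -natr1 mulrDl mul1r mulrDr mulr1.
  have : 0 <= theta * j%:R by rewrite mulr_ge0// ltW.
  by lra.
apply: (@dvg_harmonic R); apply: nondecreasing_is_cvgn.
  by apply: nondecreasing_series => j _ _; exact: harmonic_ge0.
exists (\sum_(0 <= j < M) harmonic j + U / (gamma * theta / (theta + 1))) => _ [L _ <-].
rewrite /series/=; apply: (@le_trans _ _ (\sum_(0 <= j < M + L) harmonic j)).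
  rewrite (@big_cat_nat _ _ _ L 0 (M + L))//= ?leq_addl// lerDl.
  by apply: sumr_ge0 => j _; exact: harmonic_ge0.
rewrite (@big_cat_nat _ _ _ M 0 (M + L))//= ?leq_addr// lerD2l.
rewrite ler_pdivlMr// mulrC big_distrr/= /index_iota addKn.
have := H L; move/negP; rewrite -leNgt; apply: le_trans.
by apply: ler_sum => j _; exact: rate_ge.
Qed.

(** A direct second Borel-Cantelli argument: by independence, [L] empty rounds after [M] have
    probability exp of minus the sum of their rates. *)
Lemma Kplus_eventually0 M :
  P (\bigcap_(j in [set j | (M <= j)%N]) (Kplus j @^-1` [set 0%N])) = 0%E.
Proof.
set A := \bigcap_(j in _) _.
have mA : measurable A.
  apply: bigcap_measurableType => j _.
  by rewrite -[X in measurable X]setTI; exact: measurable_funPT.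
have H L : (P A <= (expR (- \sum_(j <- iota M L) rate j))%:E)%E.
  have -> : ((expR (- \sum_(j <- iota M L) rate j))%:E =
      P (\bigcap_(j in [set` iota M L]) Kplus j @^-1` [set 0%N]))%E.
    rewrite (ibp_counts_independent ibp)//; last exact: iota_uniq.
    rewrite -sumrN expR_sum -prodEFin; apply: eq_bigr => j _.
    by rewrite (prob_Kplus gamma_gt0 theta_gt0 ibp) expr0 fact0 divr1 mul1r.
  apply: le_measure; rewrite ?inE//.
    apply: fin_bigcap_measurable => [|j _]; first exact: finite_seq.
    by rewrite -[X in measurable X]setTI; exact: measurable_funPT.
  by move=> w Aw j; rewrite /= mem_iota => /andP[Mj _]; exact: Aw.
apply/eqP; rewrite eq_le measure_ge0 andbT.
apply/lee_addgt0Pr => e e0; rewrite add0e.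
(* If the sum S of the rates exceeds 1 / e, then exp (- S) <= 1 / (1 + S) <= e. *)
have [L Le] := stick_rate_unbounded M e^-1.
apply: (le_trans (H L)); rewrite lee_fin expRN.
rewrite invf_ple ?posrE ?expR_gt0//.
apply: (le_trans (ltW Le)); apply: le_trans (expR_ge1Dx _).
by rewrite lerDr.
Qed.

Lemma measurable_total_lt N n :
  measurable [set w | (\sum_(0 <= j < N) Kplus j w < n)%N].
Proof.
have mS : measurable_fun setT (fun w => (\sum_(0 <= j < N) Kplus j w)%N).
  elim: N => [|N IH].
    by under eq_fun do rewrite big_geq//; exact: measurable_cst.
  under eq_fun do rewrite big_nat_recr//=.
  by apply: measurable_fun_addn.
by rewrite -[X in measurable X]setTI; exact: (mS measurableT [set m | (m < n)%N]).
Qed.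

(** Natural numbers with bounded partial sums vanish from some index on. *)
Lemma Kplus_bounded0 n :
  P (\bigcap_N [set w | (\sum_(0 <= j < N) Kplus j w < n)%N]) = 0%E.
Proof.
set A := \bigcap_N _.
have mA : measurable A.
  by apply: bigcap_measurableType => N _; exact: measurable_total_lt.
suff : P.-negligible A by move/negligibleP; exact.
apply: (@negligibleS _ _ _ P (\bigcup_M
    \bigcap_(j in [set j | (M <= j)%N]) (Kplus j @^-1` [set 0%N]))); last first.
  apply: negligible_bigcup => M; apply/negligibleP; last exact: Kplus_eventually0.
  apply: bigcap_measurableType => j _.
  by rewrite -[X in measurable X]setTI; exact: measurable_funPT.
move=> w Aw; apply: contrapT => H.
have step M : exists2 j, (M <= j)%N & (0 < Kplus j w)%N.
  apply: contrapT => H'; apply: H; exists M => // j /= Mj.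
  apply/eqP; rewrite -leqn0 leqNgt; apply/negP => j0; apply: H'; by exists j.
have grow m : exists N, (m <= \sum_(0 <= j < N) Kplus j w)%N.
  elim: m => [|m [N mN]]; first by exists 0%N.
  have [j Nj j0] := step N; exists j.+1.
  rewrite big_nat_recr//= (@big_cat_nat _ _ _ N 0 j)//=.
  rewrite -addn1 -addnA leq_add//.
  exact: leq_trans j0 (leq_addl _ _).
have [N nN] := grow n.
by have := Aw N I; rewrite /= ltnNge nN.
Qed.

End StickCount.

Section CountableUnion.
Context (R : realType) (K : countType).
Context (d : measure_display) (Omega : measurableType d) (P : probability Omega R).
Context (d' : measure_display) (Omega' : measurableType d') (P' : probability Omega' R).

Let index (S : Type) (F : K -> set S) (m : nat) : set S := oapp F set0 (pickle_inv m).

Let bigcup_index (S : Type) (F : K -> set S) : \bigcup_m index F m = \bigcup_k F k.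
Proof.
apply/seteqP; split => w.
  by move=> [m _]; rewrite /index; case: pickle_inv => //= k Fk; exists k.
by move=> [k _ Fk]; exists (pickle k) => //; rewrite /index pickleK_inv.
Qed.

Let trivIset_index (S : Type) (F : K -> set S) :
  trivIset setT F -> trivIset setT (index F).
Proof.
move=> tF m m' _ _ [w []]; rewrite /index.
case E : (pickle_inv m) => [k|]//=; case E' : (pickle_inv m') => [k'|]//= Fk Fk'.
have kk' : k = k' by apply: tF => //; exists w.
have := @pickle_invK K m; have := @pickle_invK K m'.
by rewrite E E' /= kk' => -> ->.
Qed.

Let measurable_index (e : measure_display) (S : measurableType e) (F : K -> set S) m :
  (forall k, measurable (F k)) -> measurable (index F m).
Proof. by move=> mF; rewrite /index; case: pickle_inv => [k|] /=. Qed.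

Lemma le_measure_countable_bigcup (F : K -> set Omega') (H : K -> set Omega) :
  (forall k, measurable (F k)) -> (forall k, measurable (H k)) ->
  trivIset setT F -> trivIset setT H -> (forall k, P' (F k) <= P (H k))%E ->
  (P' (\bigcup_k F k) <= P (\bigcup_k H k))%E.
Proof.
move=> mF mH tF tH FH; rewrite -!bigcup_index.
rewrite measure_semi_bigcup//; last 3 first.
- by move=> m; exact: measurable_index.
- exact: trivIset_index.
- by apply: bigcupT_measurable => m; exact: measurable_index.
rewrite measure_semi_bigcup//; last 3 first.
- by move=> m; exact: measurable_index.
- exact: trivIset_index.
- by apply: bigcupT_measurable => m; exact: measurable_index.
apply: lee_nneseries => [*|m _]; first exact: measure_ge0.
rewrite /index.
by case: pickle_inv => //=; rewrite !measure0.
Qed.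

End CountableUnion.

(** * From boxes to the law of a sequence *)

Section SequenceLaw.
Context (R : realType).
Context (d : measure_display) (Omega : measurableType d) (P : probability Omega R).
Context (d' : measure_display) (Omega' : measurableType d') (P' : probability Omega' R).
Context (X : nat -> Omega -> R) (Y : nat -> Omega' -> R).
Hypothesis mX : forall i, measurable_fun setT (X i).
Hypothesis mY : forall i, measurable_fun setT (Y i).

Definition box (S : Type) (U : nat -> S -> R) n (B : nat -> set R) : set S :=
  [set w | forall i, (i < n)%N -> B i (U i w)].

Lemma measurable_box (e : measure_display) (S : measurableType e) (U : nat -> S -> R) n
    (B : nat -> set (measurableTypeR R)) :
  (forall i, measurable_fun setT (U i)) ->
  (forall i, measurable (B i)) -> measurable (box U n B).
Proof.
move=> mU mB.
have -> : box U n B = \bigcap_(i in [set i | (i < n)%N]) (U i @^-1` B i).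
  by apply/seteqP; split => w H i /= => /H.
apply: bigcap_measurableType => i _.
by rewrite -[X in measurable X]setTI; apply: mU => //; exact: mB.
Qed.

Hypothesis box_le : forall n (B : nat -> set (measurableTypeR R)),
  (forall i, measurable (B i)) -> (P' (box Y n B) <= P (box X n B))%E.

(* One inequality on boxes suffices: the complement of a box is a finite
   disjoint union of boxes and both laws have mass 1. *)
Lemma box_eq n (B : nat -> set (measurableTypeR R)) :
  (forall i, measurable (B i)) -> P (box X n B) = P' (box Y n B).
Proof.
elim: n B => [|n IH] B mB.
  have boxT (S : Type) (U : nat -> S -> R) : box U 0 B = setT.
    by apply/seteqP; split.
  by rewrite !boxT !probability_setT.
(* The sides [B n] and its complement split the box in the first n coordinates, where equality holds
   by induction. Two inequalities between finite numbers whose sums agree are equalities. *)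
pose B1 i := if i == n then ~` B n else B i.
have mB1 i : measurable (B1 i) by rewrite /B1; case: ifP => // _; exact: measurableC.
have boxS (S : Type) (U : nat -> S -> R) A : box U n.+1 (fun i => if i == n then A else B i) =
    box U n B `&` U n @^-1` A.
  apply/seteqP; split => w.
    move=> H; split.
      by move=> i ni; have := H i (ltnW ni); rewrite ltn_eqF.
    by have := H n (ltnSn n); rewrite eqxx.
  move=> [H Un] i; rewrite ltnS leq_eqVlt => /predU1P[->|ni]; first by rewrite eqxx.
  by rewrite ltn_eqF//; exact: H.
have split_box (e : measure_display) (S : measurableType e) (Q : probability S R)
    (U : nat -> S -> R) : (forall i, measurable_fun setT (U i)) ->
    (Q (box U n B) = Q (box U n.+1 B) + Q (box U n.+1 B1))%E.
  move=> mU.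
  have -> : box U n.+1 B = box U n B `&` U n @^-1` B n.
    rewrite -boxS; congr box; apply/funext => i.
    by case: eqP => // ->.
  rewrite boxS preimage_setC -setDE addeC; apply: measureDI.
    exact: measurable_box.
  by rewrite -[X in measurable X]setTI; apply: mU => //; exact: mB.
have le0 := box_le n.+1 mB; have le1 := box_le n.+1 mB1.
have := IH B mB; rewrite (split_box _ _ P X mX) (split_box _ _ P' Y mY).
have fin (e : measure_display) (S : measurableType e) (Q : probability S R)
    (U : nat -> S -> R) (A : nat -> set (measurableTypeR R)) :
    (forall i, measurable_fun setT (U i)) -> (forall i, measurable (A i)) ->
    Q (box U n.+1 A) \is a fin_num.
  by move=> mU mA; apply: fin_num_measure; exact: measurable_box.
move: le0 le1.
rewrite -(fineK (fin _ _ P X B mX mB)) -(fineK (fin _ _ P X B1 mX mB1)).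
rewrite -(fineK (fin _ _ P' Y B mY mB)) -(fineK (fin _ _ P' Y B1 mY mB1)).
rewrite -!EFinD !lee_fin => le0 le1 [e]; congr EFin.
by apply/eqP; rewrite eq_le le0 andbT; move: le1 e; lra.
Qed.

Lemma same_sequence_law_box : same_sequence_law P P' X Y.
Proof.
pose G : set (set (nat -> R)) := [set A | exists n (B : nat -> set (measurableTypeR R)),
  (forall i, measurable (B i)) /\ A = box (fun i (x : nat -> R) => x i) n B].
pose T := g_sigma_algebraType G.
(* Measurability of the two preimages is carried through the same induction, since the complement
   and union steps rely on it. *)
pose good (C : set T) := [/\ measurable [set w | C (fun k => X k w)],
  measurable [set w | C (fun k => Y k w)] &
  P [set w | C (fun k => X k w)] = P' [set w | C (fun k => Y k w)]].
have GI : setI_closed G.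
  move=> _ _ [n [B [mB ->]]] [n' [B' [mB' ->]]].
  exists (maxn n n'), (fun i => (if (i < n)%N then B i else setT) `&`
    (if (i < n')%N then B' i else setT)); split.
    by move=> i; apply: measurableI; case: ifP.
  apply/seteqP; split => x.
    by move=> [H H'] i _; split; case: ifP => // ?; [exact: H|exact: H'].
  move=> H; split => i ni.
    by have := H i; rewrite leq_max ni/= => /(_ isT)[].
  by have := H i; rewrite leq_max ni orbT => /(_ isT)[].
have Ggood : G `<=` good.
  move=> _ [n [B [mB ->]]]; split; [exact: measurable_box|exact: measurable_box|exact: box_eq].
move=> C sC.
have sub : sigma_gen (fun k (x : nat -> R) => x k) `<=` <<s G >>.
  apply: smallest_sub; first exact: smallest_sigma_algebra.
  move=> _ [i _ [B mB <-]]; apply: sub_sigma_algebra.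
  exists i.+1, (fun j => if j == i then B else setT); split.
    by move=> j; case: ifP.
  rewrite setTI; apply/seteqP; split => x /=.
    by move=> Bx j _; case: eqP => // ->.
  by move=> /(_ i (ltnSn i)); rewrite eqxx.
have [] // : good C.
apply: (@dynkin_induction _ T G good) => //.
- split; [exact: measurableT|exact: measurableT|].
  exact: (etrans (probability_setT P) (esym (probability_setT P'))).
- move=> A mA [m1 m2 e]; split; rewrite ?probability_setC//.
  + exact: measurableC.
  + exact: measurableC.
  + by congr (1 - _)%E; exact: e.
- move=> F mF tF gF.
  have mX' k : measurable [set w | F k (fun k => X k w)] by case: (gF k).
  have mY' k : measurable [set w | F k (fun k => Y k w)] by case: (gF k).
  split; [exact: bigcupT_measurable|exact: bigcupT_measurable|].
  have tX : trivIset setT (fun k => [set w | F k (fun k => X k w)]).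
    by move=> i j _ _ [w [Fi Fj]]; apply: tF => //; exists (fun k => X k w).
  have tY : trivIset setT (fun k => [set w | F k (fun k => Y k w)]).
    by move=> i j _ _ [w [Fi Fj]]; apply: tF => //; exists (fun k => Y k w).
  apply: (etrans (measure_semi_bigcup P mX' tX (bigcupT_measurable _ mX'))).
  apply: (etrans _ (esym (measure_semi_bigcup P' mY' tY (bigcupT_measurable _ mY')))).
  by apply: eq_eseriesr => k _; case: (gF k).
- exact: sub.
Qed.

End SequenceLaw.

(** The draws determine the set of labels of each round; only the order inside the lists is free.
    This makes the events [rounds_shaped] for different [k] of the same length disjoint. *)
Lemma first_rounds_shape_inj (d : measure_display) (Omega : measurableType d)
    (R : realType) (P : probability Omega R) (Z : nat -> nat -> {RV P >-> bool})
    k k' w : size k = size k' -> rounds_shaped Z k w -> rounds_shaped Z k' w -> k = k'.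
Proof.
move=> skk' [b [bk ub fb]] [b' [bk' ub' fb']].
have sb : size b = size b' by rewrite -(size_map size b) -(size_map size b') -/(shape b) -/(shape b') bk bk'.
rewrite -bk -bk'; apply: (@eq_from_nth _ 0%N); rewrite ?size_map// => j jb.
rewrite !(nth_map [::])//; last by rewrite -sb.
have ubj c : uniq (flatten c) -> (j < size c)%N -> uniq (nth [::] c j).
  by move=> /uniq_flatten_all/allP uc jc; apply: uc; exact: mem_nth.
apply: perm_size; apply: uniq_perm.
- exact: ubj.
- by apply: ubj => //; rewrite -sb.
move=> l; have h := fb j l jb; have h' := fb' j l; rewrite -sb in h'.
by apply/idP/idP => [/h/(h' jb)//|/(h' jb)/h].
Qed.

(** * The box inequality *)

Section Main.
Context (R : realType) (gamma theta : R).
Hypotheses (gamma_gt0 : 0 < gamma) (theta_gt0 : 0 < theta).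
Local Notation E := (measurableTypeR R * measurableTypeR R)%type.
Local Notation levy := (beta_process_levy gamma_gt0 theta_gt0).
Context (d : measure_display) (Omega : measurableType d) (P : probability Omega R).
Context (jump : nat -> {RV P >-> E}) (Z : nat -> nat -> {RV P >-> bool}).
Context (sigma : nat -> {RV P >-> nat}).
Context (d' : measure_display) (Omega' : measurableType d') (P' : probability Omega' R).
Context (Kplus : nat -> {RV P' >-> nat}) (V : nat -> {RV P' >-> R}).
Hypothesis ppp : poisson_point_process jump (jump_intensity levy).
Hypothesis featZ : feature_allocation jump Z.
Hypothesis ooa : order_of_appearance jump Z sigma.
Hypothesis ibp : ibp_stick_lengths gamma theta Kplus V.

Let xi i w := (jump (sigma i w) w).1.
Let enough n N : set Omega' := [set w | (n <= \sum_(0 <= j < N) Kplus j w)%N].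

Lemma measurable_sorted_jump i : measurable_fun setT (xi i).
Proof.
move=> _ A mA; rewrite setTI; exact: (measurable_sorted_size jump sigma i mA).
Qed.

Let mV i : measurable_fun setT (V i).
Proof. exact: measurable_funPT. Qed.

Let measurable_enough n N : measurable (enough n N).
Proof.
have -> : enough n N = ~` [set w | (\sum_(0 <= j < N) Kplus j w < n)%N].
  apply/seteqP; split => w; rewrite /enough/=; first by rewrite leqNgt => /negP.
  by move=> /negP; rewrite -leqNgt.
by apply: measurableC; exact: measurable_total_lt.
Qed.

(** Both sides are decomposed according to the sizes [k] of the first [N] rounds: with at least [n]
    entries in total, these rounds determine the box, and the comparison is made for each [k]. *)
Lemma sticks_box_le_enough n N (B : nat -> set (measurableTypeR R)) :
  (forall i, measurable (B i)) ->
  (P' (box (fun i => V i) n B `&` enough n N) <= P (box xi n B))%E.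
Proof.
(* The rounds may contain more than [n] entries; the surplus positions are left free. *)
move=> mB; pose B' i : set (measurableTypeR R) := if (i < n)%N then B i else setT.
have mB' i : measurable (B' i) by rewrite /B'; case: ifP.
pose F (k : seq nat) := if (size k == N) && (n <= sumn k)%N
  then counts_are Kplus k `&` sticks_in V k B' else set0.
pose H (k : seq nat) := if (size k == N) && (n <= sumn k)%N
  then rounds_shaped Z k `&` sorted_sizes_in jump sigma k B' else set0.
have mF k : measurable (F k).
  rewrite /F; case: ifP => // _.
  by apply: measurableI; [exact: measurable_counts_are|exact: measurable_sticks_in].
have mH k : measurable (H k).
  rewrite /H; case: ifP => // _.
  by apply: measurableI; [exact: measurable_rounds_shaped|exact: measurable_sorted_sizes_in].
apply: (@le_trans _ _ (P' (\bigcup_k F k))).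
  apply: le_measure; rewrite ?inE.
  - by apply: measurableI => //; exact: measurable_box.
  - by apply: countable_bigcupT_measurable => //; exact: countableP.
  move=> w [Bw nw]; exists (mkseq (Kplus ^~ w) N) => //.
  have sE : sumn (mkseq (Kplus ^~ w) N) = (\sum_(0 <= j < N) Kplus j w)%N.
    by rewrite sumnE big_map /index_iota subn0.
  rewrite /F size_mkseq eqxx sE nw/=; split.
    by move=> j; rewrite size_mkseq => jN; rewrite nth_mkseq.
  by move=> i _; rewrite /B'; case: ifP => // /Bw.
apply: (@le_trans _ _ (P (\bigcup_k H k))).
  apply: le_measure_countable_bigcup => //.
  - move=> k k' _ _ [w []]; rewrite /F.
    case: ifP => // /andP[/eqP kN _]; case: ifP => // /andP[/eqP kN' _] [kw _] [kw' _].
    apply: (@eq_from_nth _ 0%N); first by rewrite kN.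
    by move=> j jk; rewrite -kw// -kw'// kN' -kN.
  - move=> k k' _ _ [w []]; rewrite /H.
    case: ifP => // /andP[/eqP kN _]; case: ifP => // /andP[/eqP kN' _] [kw _] [kw' _].
    by apply: (first_rounds_shape_inj _ kw kw'); rewrite kN.
  - move=> k; rewrite /F /H; case: ifP => _; last by rewrite !measure0.
    exact: (counts_sticks_le_rounds ppp featZ ooa ibp k mB').
apply: le_measure; rewrite ?inE.
- by apply: countable_bigcupT_measurable => //; exact: countableP.
- by apply: measurable_box => // i; exact: measurable_sorted_jump.
move=> w [k _]; rewrite /H; case: ifP => // /andP[_ nk] [_ Hw] i ni.
by have := Hw i (leq_trans ni nk); rewrite /B' ni.
Qed.

(** As [N] grows, the event of having [n] sticks increases to an event of probability 1, by
    [Kplus_bounded0]. *)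
Lemma sticks_box_le n (B : nat -> set (measurableTypeR R)) :
  (forall i, measurable (B i)) ->
  (P' (box (fun i => V i) n B) <= P (box xi n B))%E.
Proof.
move=> mB; pose D N := box (fun i => V i) n B `&` enough n N.
have mbox : measurable (box (fun i => V i) n B) by exact: measurable_box.
have mD N : measurable (D N) by exact: measurableI.
have mUD : measurable (\bigcup_N D N) by exact: bigcupT_measurable.
have cvgD : (P' (D N) @[N --> \oo] --> P' (\bigcup_N D N))%E.
  apply: nondecreasing_cvg_mu => // N N' NN'; rewrite subsetEset; apply: setIS => w.
  rewrite /enough/= => /leq_trans; apply.
  by rewrite [leqRHS](@big_cat_nat _ _ _ N)//= leq_addr.
have mS : measurable (\bigcap_N [set w | (\sum_(0 <= j < N) Kplus j w < n)%N]).
  by apply: bigcap_measurableType => N _; exact: measurable_total_lt.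
apply: (@le_trans _ _ (P' (\bigcup_N D N))); last first.
  rewrite -(cvg_lim _ cvgD)//; apply: lime_le; first by apply/cvg_ex; eexists; exact: cvgD.
  by apply: nearW => N; exact: sticks_box_le_enough.
apply: (@le_trans _ _ (P' (\bigcup_N D N `|`
    \bigcap_N [set w | (\sum_(0 <= j < N) Kplus j w < n)%N]))).
  apply: le_measure; rewrite ?inE//; first exact: measurableU.
  move=> w Bw; have [[N nN]|] := pselect (exists N, enough n N w).
    by left; exists N.
  by move=> /forallNP nw; right => N _ /=; rewrite ltnNge; exact/negP/nw.
apply: (le_trans (measureU2 _ _ _)) => //.
by rewrite [X in (_ + X <= _)%E](Kplus_bounded0 gamma_gt0 theta_gt0 ibp n) adde0.
Qed.

End Main.

Unset Implicit Arguments.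

Theorem theorem16 (R : realType) (gamma theta : R)
  (gamma_gt0 : 0 < gamma) (theta_gt0 : 0 < theta)
  (d : measure_display) (Omega : measurableType d) (P : probability Omega R)
  (T : R -> {RV P >-> R})
  (jump : nat -> {RV P >-> (measurableTypeR R * measurableTypeR R)%type})
  (Z : nat -> nat -> {RV P >-> bool})
  (sigma : nat -> {RV P >-> nat})
  (d' : measure_display) (Omega' : measurableType d')
  (P' : probability Omega' R)
  (Kplus : nat -> {RV P' >-> nat}) (V : nat -> {RV P' >-> R}) :
  zero_drift_subordinator (beta_process_levy gamma_gt0 theta_gt0) T jump ->
  feature_allocation jump Z ->
  order_of_appearance jump Z sigma ->
  ibp_stick_lengths gamma theta Kplus V ->
  same_sequence_law P P' (fun k w => (jump (sigma k w) w).1) V.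
Proof.
move=> [_ ppp _] featZ ooa ibp; apply: same_sequence_law_box.
- exact: measurable_sorted_jump.
- by move=> i; exact: measurable_funPT.
- by move=> n B mB; apply: (sticks_box_le ppp featZ ooa ibp).
Qed.
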